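(* Let $\xi$ be a real valued Lévy process with Lévy measure $\Pi$ such that $\Pi]0,\infty[>0$. Let $H$ and $\widehat H$ be its ladder height and dual ladder height subordinators. (a) Assume that $\widehat H$ has finite mean $\mu=\mathbf E(\widehat H_1)<\infty$. The following are equivalent: (a-1) the measure $\Pi_I^+$ on $[0,\infty[$ with tail $\overline\Pi_I^+(x)=\int_x^\infty\overline\Pi^+(z)\,dz$, $x\ge0$, belongs to $\mathcal L^0$; (a-2) $po\in\mathcal L^0$; (a-3) $\overline{po}(x)\sim\frac1\mu\overline\Pi_I^+(x)$ as $x\to\infty$. (b) Assume that $\widehat H$ has killing term $\widehat k_0>0$. The following are equivalent: (b-1) $\Pi^+=\Pi|_{]0,\infty[}\in\mathcal L^0$; (b-2) $po\in\mathcal L^0$, $$\frac{\widehat d\,\overline p(x)}{\overline{po}(x)}\longrightarrow0\quad\text{and}\quad\int_0^1\left(\frac{\overline{po}(x)-\overline{po}(x+y)}{\overline{po}(x)}\right)ne(dy)\longrightarrow0,\quad\text{as }x\to\infty;$$ (b-3) $\overline{po}(x)\sim\frac1{\widehat k_0}\overline\Pi^+(x)$ as $x\to\infty$.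
   Context: $S_t=\sup_{s\le t}\xi_s$, $L$ is the local time at $0$ of the strong Markov process $S-\xi$, $L^{-1}$ its right-continuous inverse, and $H_t=S_{L^{-1}_t}$ (with $H_t=\infty$ once $L^{-1}_t=\infty$) is the ladder height subordinator, possibly killed. $\widehat H$ is the ladder height subordinator of the dual process $\widehat\xi=-\xi$. The killing rate, drift and Lévy measure of $H$ are $(k_0,d,po)$ and those of $\widehat H$ are $(\widehat k_0,\widehat d,ne)$. $\widehat V(dx)=\mathbf E\left(\int_0^\infty 1_{\{\widehat H_t\in dx\}}dt\right)$ is the potential measure of $\widehat H$. Tails: $\overline{po}(x)=po]x,\infty[$, $\overline{ne}(x)=ne]x,\infty[$, $\overline\Pi^+(x)=\Pi]x,\infty[$ for $x>0$. The local times are normalized so that the following identities of Vigon hold for all $x>0$: $\overline{po}(x)=\int_0^\infty\widehat V(dy)\,\overline\Pi^+(x+y)$, and $\overline\Pi^+(x)=\int_{]x,\infty[}po(dy)\,\overline{ne}(y-x)+\widehat d\,\overline p(x)+\widehat k_0\,\overline{po}(x)$, where $\overline p$ is the density of the measure $po$, which exists if $\widehat d>0$ (the version satisfying this identity for every $x>0$); if $\widehat d=0$ the term $\widehat d\,\overline p(x)$ is $0$. $\mathcal L^0$ (long tailed measures): a measure $M$ on $[0,\infty[$ belongs to $\mathcal L^0$ if its tail $\overline M(x)=M]x,\infty[$ satisfies $0<\overline M(x)<\infty$ for each $x>0$ and $\lim_{x\to\infty}\overline M(x+t)/\overline M(x)=1$ for each $t\in\mathbb R$. $f\sim g$ means 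$f/g\to1$.
   Formalization: The implications from (a-3) are claimed only if ne is nonzero, and those from (b-3) only if ne is nonzero or the drift of Ĥ is positive; otherwise (a-3), (b-3) hold automatically and the claim can fail, e.g. for -t plus compound Poisson with exponential jumps. *)

(* Defs.v *)
From HB Require Import structures.
From mathcomp Require Import all_boot all_order all_algebra.
From mathcomp Require Import finmap.
From mathcomp Require Import all_classical all_reals all_analysis.
From mathcomp Require Import measurable_realfun.

Set Implicit Arguments.
Unset Strict Implicit.
Unset Printing Implicit Defensive.

Import Order.TTheory GRing.Theory Num.Theory.
Import numFieldNormedType.Exports.

Local Open Scope classical_set_scope.
Local Open Scope ring_scope.

(* Processes are indexed by [R] but only their values at times [t >= 0] are
   ever constrained or used. *)

Section filtrations.
Context {R : realType} {d : measure_display} {T : measurableType d}.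
Implicit Types (F : R -> set (set T)) (X : R -> T -> R) (tau : T -> \bar R).

Definition filtration F : Prop :=
  (forall t, 0 <= t -> sigma_algebra [set: T] (F t)) /\
  (forall t, 0 <= t -> F t `<=` measurable) /\
  (forall s t, 0 <= s -> s <= t -> F s `<=` F t).

Definition adapted F X : Prop :=
  forall t (B : set R), 0 <= t -> measurable B -> F t (X t @^-1` B).

Definition stopping_time F tau : Prop :=
  (forall w, (0%:E <= tau w)%E) /\
  (forall t, 0 <= t -> F t [set w | (tau w <= t%:E)%E]).

Definition stopped_sigma F tau : set (set T) :=
  [set A | measurable A /\
    forall t, 0 <= t -> F t (A `&` [set w | (tau w <= t%:E)%E])].

Definition cadlag (x : R -> R) : Prop :=
  (forall t, 0 <= t -> x s @[s --> t^'+] --> x t) /\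
  (forall t, 0 < t -> cvg (x s @[s --> t^'-])).

End filtrations.

Section levy_processes.
Context {R : realType} {d : measure_display} {T : measurableType d}.
Variable P : probability T R.
Implicit Types (F : R -> set (set T)) (xi L : R -> T -> R).
Implicit Types (Pi nu : {measure set (measurableTypeR R) -> \bar R}).

(* Taking [A := setT] in the last clause gives stationarity of the
   increments. *)
Definition levy_process F xi : Prop :=
  [/\ filtration F, adapted F xi,
      forall w, xi 0 w = 0,
      forall w, cadlag (xi ^~ w) &
      forall (s t : R) (A : set T) (B : set R), 0 <= s -> 0 <= t -> F t A ->
        measurable B ->
        P (A `&` [set w | B (xi (t + s) w - xi t w)]) =
        (P A * P [set w | B (xi s w)])%E].

(* Levy-Khintchine formula E(e^{i l xi_t}) = e^{-t Psi(l)} with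
   Psi(l) = i a l + q l^2 / 2
            + \int (1 - e^{i l x} + i l x 1_{|x| < 1}) Pi(dx),
   split into its real and imaginary parts. *)
Definition levy_exponent_re (q : R) Pi (l : R) : R :=
  q * l ^+ 2 / 2 + \int[Pi]_x (1 - cos (l * x)).

Definition levy_exponent_im (a : R) Pi (l : R) : R :=
  a * l + \int[Pi]_x (l * x * \1_`]-1, 1[ x - sin (l * x)).

Definition levy_measure_of xi Pi : Prop :=
  [/\ Pi [set 0] = 0%E,
      (\int[Pi]_x (Num.min 1 (x ^+ 2))%:E < +oo)%E &
      exists a q, 0 <= q /\ forall t l, 0 <= t ->
        \int[P]_w cos (l * xi t w) =
          expR (- (t * levy_exponent_re q Pi l)) *
            cos (t * levy_exponent_im a Pi l) /\
        \int[P]_w sin (l * xi t w) =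
          - (expR (- (t * levy_exponent_re q Pi l)) *
            sin (t * levy_exponent_im a Pi l))].

Definition running_sup xi (t : R) (w : T) : R :=
  sup [set xi s w | s in `[0, t]%classic].

Definition reflected xi (t : R) (w : T) : R := running_sup xi t w - xi t w.

Definition max_times xi (w : T) : set R :=
  [set t | 0 <= t /\ reflected xi t w = 0].

(* Regularity of 0 for itself for the reflected process. *)
Definition max_regular xi : Prop :=
  {ae P, forall w, forall e, 0 < e ->
     exists t, [/\ 0 < t, t < e & max_times xi w t]}.

(* Local time at 0 of the reflected process when 0 is regular for itself:
   a continuous adapted increasing process, growing exactly on the closure of
   the zero set, and additive at stopping times taking values in it. *)
Definition regular_local_time F xi L : Prop :=
  [/\ adapted F L,
      forall w, L 0 w = 0,
      forall w s t, 0 <= s -> s <= t -> L s w <= L t w,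
      forall w, {within `[0, +oo[, continuous (L ^~ w)} &
      {ae P, forall w, forall t, 0 <= t ->
         (closure (max_times xi w) t <->
          forall e, 0 < e -> L (Num.max 0 (t - e)) w < L (t + e) w)} /\
      forall tau : T -> \bar R, stopping_time F tau ->
        {ae P, forall w, (tau w < +oo)%E -> max_times xi w (fine (tau w))} ->
        forall (A : set T) (n : nat) (u : 'I_n -> R) (B : 'I_n -> set (R * R)),
          stopped_sigma F tau A ->
          (forall i, 0 <= u i) -> (forall i, measurable (B i)) ->
          P (A `&` [set w | (tau w < +oo)%E /\ forall i,
               B i (xi (fine (tau w) + u i) w - xi (fine (tau w)) w,
                    L (fine (tau w) + u i) w - L (fine (tau w)) w)]) =
          (P (A `&` [set w | (tau w < +oo)%E]) *
           P [set w | forall i, B i (xi (u i) w, L (u i) w)])%E].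

Definition process_sigma xi : set (set T) :=
  <<s [set A : set T | exists (t : R) (B : set R),
         [/\ 0 <= t, measurable B & A = xi t @^-1` B]] >>.

(* When 0 is irregular for itself the zero set is a.s. discrete, and the local
   time puts at its successive points (0 included) i.i.d. exponential masses
   independent of [xi]. *)
Definition irregular_local_time xi L : Prop :=
  [/\ forall w t, 0 <= t -> 0 <= L t w,
      forall w s t, 0 <= s -> s <= t -> L s w <= L t w,
      forall w t, 0 <= t -> L s w @[s --> t^'+] --> L t w &
      exists (c : R) (e : nat -> T -> R),
      [/\ 0 < c,
          forall i, measurable_fun setT (e i),
          forall (n : nat) (A : set T) (B : 'I_n -> set R),
            process_sigma xi A -> (forall i, measurable (B i)) ->
            P (A `&` [set w | forall i, B i (e i w)]) =
            (P A * \prod_(i < n) exponential_prob c (B i))%E &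
          {ae P, forall w, forall t, 0 <= t ->
             L t w = \sum_(i < #|` fset_set (max_times xi w `&` `[0, t])|)
                        e i w}]].

Definition dual_process xi : R -> T -> R := fun t w => - xi t w.

Definition local_time_at_max F xi L : Prop :=
  (max_regular xi -> regular_local_time F xi L) /\
  (~ max_regular xi -> irregular_local_time xi L).

Definition inverse_local_time L (t : R) (w : T) : \bar R :=
  ereal_inf [set s%:E | s in [set s : R | 0 <= s /\ t < L s w]].

Definition ladder_height xi L (t : R) (w : T) : \bar R :=
  if inverse_local_time L t w is s%:E then (running_sup xi s w)%:E else +oo%E.

End levy_processes.

Section subordinators.
Context {R : realType} {d : measure_display} {T : measurableType d}.
Variable P : probability T R.
Implicit Types (H : R -> T -> \bar R).
Implicit Types (nu : {measure set (measurableTypeR R) -> \bar R}).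

Definition past_sigma H (t : R) : set (set T) :=
  <<s [set A : set T | exists (s : R) (B : set (\bar R)),
         [/\ 0 <= s, s <= t, measurable B & A = H s @^-1` B]] >>.

Definition killed_subordinator H : Prop :=
  [/\ forall t, 0 <= t -> measurable_fun setT (H t),
      {ae P, forall w, H 0 w = 0%E},
      forall w s t, 0 <= s -> s <= t -> (0%:E <= H s w <= H t w)%E,
      forall w t, 0 <= t -> H s w @[s --> t^'+] --> H t w &
      forall (s t : R) (A : set T) (B : set (\bar R)), 0 <= s -> 0 <= t ->
        past_sigma H t A -> measurable B ->
        P (A `&` [set w | (H t w < +oo)%E /\ B (H (t + s)%R w - H t w)%E]) =
        (P (A `&` [set w | (H t w < +oo)%E]) * P [set w | B (H s w)])%E].

Definition laplace_exponent (k dr : R) nu (l : R) : R :=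
  k + dr * l + \int[nu]_(x in `]0, +oo[) (1 - expR (- (l * x))).

(* [k], [dr] and [nu] are the killing rate, the drift and the Levy measure
   of [H]; on the killing event e^{- l H_t} is read as 0, also for l = 0. *)
Definition characteristics H (k dr : R) nu : Prop :=
  [/\ 0 <= k /\ 0 <= dr,
      nu `]-oo, 0]%classic = 0%E,
      (\int[nu]_(x in `]0%R, +oo[) (Num.min 1 x)%:E < +oo)%E &
      forall t l, 0 <= t -> 0 <= l ->
        \int[P]_(w in [set w | (H t w < +oo)%E]) expR (- (l * fine (H t w))) =
        expR (- (t * laplace_exponent k dr nu l))].

Definition potential H (B : set (\bar R)) : \bar R :=
  (\int[P]_w \int[lebesgue_measure]_(t in `[0%R, +oo[) (\1_B (H t w))%:E)%E.

Definition potential_measure_of H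
    (V : {measure set (measurableTypeR R) -> \bar R}) : Prop :=
  forall B : set R, measurable B -> V B = potential H (EFin @` B).

End subordinators.

Section tails.
Context {R : realType}.
Implicit Types (M N : {measure set (measurableTypeR R) -> \bar R}).

Definition tail M (x : R) : \bar R := M `]x, +oo[%classic.

Definition long_tailed M : Prop :=
  [/\ M `]-oo, 0[%classic = 0%E,
      forall x, 0 < x -> (0%:E < tail M x < +oo)%E &
      forall t, fine (tail M (x + t)) / fine (tail M x) @[x --> +oo] --> (1 : R)].

Definition asymp_equiv (f g : R -> R) : Prop :=
  f x / g x @[x --> +oo] --> (1 : R).

(* The density [p] is only relevant on ]0, +oo[, where the measure lives. *)
Definition density_on_pos M (p : R -> R) : Prop :=
  [/\ measurable_fun (`]0, +oo[%classic : set R) p,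
      forall x, 0 < x -> 0 <= p x &
      forall B : set R, measurable B -> B `<=` `]0, +oo[ ->
        M B = (\int[lebesgue_measure]_(x in B) (p x)%:E)%E].

Definition positive_part M := mrestr M (measurable_itv `]0%R, +oo[).
HB.instance Definition _ M := Measure.on (positive_part M).

Definition integrated_tail M (A : set (measurableTypeR R)) : \bar R :=
  (\int[lebesgue_measure]_(z in A `&` `[0%R, +oo[) tail M z)%E.

Lemma measurable_tail M : measurable_fun setT (tail M).
Proof.
apply: (measurability _ (ErealGenCInfty.measurableE R)).
move=> _ [_ [r ->] <-]; rewrite setTI; apply: is_interval_measurable.
move=> x y /= Hx Hy z /andP[xz zy].
move: Hy; rewrite !in_itv/= !andbT => /le_trans; apply.
apply: le_measure; rewrite ?inE; [exact: measurable_itv|exact: measurable_itv|].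
by move=> u /=; rewrite !in_itv/= !andbT; exact: le_lt_trans.
Qed.

Let integrated_tail0 M : integrated_tail M set0 = 0%E.
Proof. by rewrite /integrated_tail set0I integral_set0. Qed.

Let integrated_tail_ge0 M A : (0 <= integrated_tail M A)%E.
Proof. by apply: integral_ge0 => z _; exact: measure_ge0. Qed.

Let integrated_tail_sigma_additive M :
  semi_sigma_additive (integrated_tail M).
Proof.
move=> /= F mF tF mUF; rewrite /integrated_tail setI_bigcupl.
have mF' i : measurable (F i `&` `[0%R, +oo[) by exact: measurableI.
apply: cvg_toP.
  apply: ereal_nondecreasing_is_cvgn => m n mn.
  apply: lee_sum_nneg_natr => // k _ _.
  by apply: integral_ge0 => z _; exact: measure_ge0.
rewrite ge0_integral_bigcup//=.
- by apply: measurable_funTS; exact: measurable_tail.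
- exact: trivIset_setIr.
Qed.

HB.instance Definition _ M := isMeasure.Build _ _ _ (integrated_tail M)
  (integrated_tail0 M) (integrated_tail_ge0 M)
  (@integrated_tail_sigma_additive M).

Lemma tail_integrated_tail M (x : R) : 0 <= x ->
  tail (integrated_tail M) x =
  (\int[lebesgue_measure]_(z in `]x, +oo[) tail M z)%E.
Proof.
move=> x0; rewrite {1}/tail /= /integrated_tail; congr (integral _ _ _).
apply: setIidl.
by move=> z /=; rewrite !in_itv/= !andbT => /ltW; exact: le_trans.
Qed.

End tails.

(* Main.v *)
Require Import Defs.
From HB Require Import structures.
From mathcomp Require Import all_boot all_order all_algebra.
From mathcomp Require Import all_classical all_reals all_analysis.
From mathcomp Require Import measurable_realfun.
From mathcomp Require Import ring lra.

(** Throughout, G is the tail of [po], and d, k, [ne] are the drift, the killing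
    rate and the jump measure of the dual ladder height. The second identity
    of Vigon writes the tail of Pi as A + d p + k G, where A(x) is the integral
    of the tail of [ne] at y - x against [po](dy), over y > x. Nearly everything
    is read off from this identity.

    Finite mean. A subordinator with finite mean mu is not killed, and
    mu = d + int s ne(ds), as the derivative of its Laplace transform at 0
    shows ([killed_subordinator_mean]). Integrated over z > x by Tonelli's
    theorem, the identity becomes
      Pi_I(x) = int_(y > x) m(y - x) po(dy),  m(u) = d + int min(s, u) ne(ds)
    ([integrated_tailE]), so that Pi_I is the tail of [po] smeared by a weight m
    which is positive on the positive half-line ([weight_gt0]) and increases
    to mu ([weight_approx]). Bounding m by constants on the pieces of
    the half-line above x gives:
      - Pi_I(x) <= mu G(x) and m(u) G(x + u) <= Pi_I(x); if G is long tailed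
        then Pi_I ~ mu G, hence Pi_I is long tailed too;
      - an increment of Pi_I is at least m(s) times an increment of G; if Pi_I
        is long tailed then so is G;
      - mu G(x) - Pi_I(x) >= (mu - m(u)) (G(x) - G(x + u)); if Pi_I ~ mu G then
        G is long tailed, as soon as m(u) < mu for some u, that is, [ne] <> 0.

    Positive killing. Now the equivalence of G with Pi / k says that the
    remainder A + d p is negligible with respect to G.
      - A negligible remainder makes G long tailed, unless both d and [ne]
        vanish: A(x) is at least c times G(x) - G(x + u) if c is the tail of
        [ne] at u, and d p integrates to d times a decrease of G
        ([slowly_of_negligible_remainder]).
      - By Tonelli's theorem A(x) is also the integral of po ]x, x + s[ against
        ne(ds) ([overshootE]). Up to the end point of the interval, its part
        s <= 1 is the integral that has to vanish, relatively to G, in the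
        second statement, and its part s > 1 is negligible when G is long tailed
        ([negligible_overshoot]). The end point matters when [po] and [ne] have
        atoms; [small_jumps_le] recovers it from values of A to the right of x.
      - If Pi is long tailed, the first identity of Vigon is used: the potential
        measure has mass 1 / k ([potential_mass]), so that G(x) is at least
        almost Pi(x + u) / k for u large, while k G <= Pi by the second
        identity. *)

Import Order.TTheory GRing.Theory Num.Theory.
Import numFieldNormedType.Exports.

Local Open Scope classical_set_scope.
Local Open Scope ring_scope.

(** * Functions that decay slowly at infinity *)

Section slow_variation.
Context {R : realType}.
Implicit Types (f g : R -> R).

Definition positive_on_pos f := forall x : R, 0 < x -> 0 < f x.

Definition nonincreasing_on_pos f :=
  forall x y : R, 0 < x -> x <= y -> f y <= f x.

(** The property of the tail that defines the class of long tailed measures. *)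
Definition slowly_decaying f :=
  forall t : R, f (x + t) / f x @[x --> +oo] --> (1 : R).

(** The upper half of [f = o(g)], the half on which the estimates rest. *)
Definition negligible_wrt f g :=
  forall e : R, 0 < e -> \forall x \near +oo, f x <= e * g x.

Lemma near_pinfty_gt (M : R) : \forall x \near +oo, M < x.
Proof. by apply: nbhs_pinfty_gt; exact: num_real. Qed.

Lemma cvg_shift_pinfty (t : R) : x + t @[x --> +oo] --> +oo.
Proof.
apply/cvgryPge => A; near=> x; rewrite -lerBlDr ltW//; near: x.
exact: near_pinfty_gt.
Unshelve. all: by end_near. Qed.

Lemma near_eq_cvg_to f g (l : R) : (\forall x \near +oo, f x = g x) ->
  f x @[x --> +oo] --> l -> g x @[x --> +oo] --> l.
Proof.
by move=> fg; apply: cvg_trans; exact: near_eq_cvg.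
Qed.

Lemma cvg1V f : f x @[x --> +oo] --> (1 : R) ->
  (f x)^-1 @[x --> +oo] --> (1 : R).
Proof.
by move=> f1; rewrite -[X in _ --> X]invr1; exact: cvgV (oner_neq0 _) f1.
Qed.

Lemma cvg_ratio1 f g : (forall x : R, 0 < x -> 0 < g x) ->
  (forall x : R, 0 < x -> f x <= g x) ->
  negligible_wrt (g \- f) g -> f x / g x @[x --> +oo] --> (1 : R).
Proof.
move=> g0 fg H; apply/cvgrPdist_le => e e0; near=> x.
have x0 : 0 < x by near: x; exact: near_pinfty_gt.
have gx := g0 _ x0.
have -> : 1 - f x / g x = (g x - f x) / g x by field; rewrite gt_eqF.
rewrite ger0_norm; last by rewrite divr_ge0 ?subr_ge0 ?fg// ltW.
rewrite ler_pdivrMr//.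
by near: x; exact: H.
Unshelve. all: by end_near. Qed.

(** A single step [u] suffices: the ratio over [n * u] is a product of [n]
    ratios over [u], monotonicity squeezes the ratio over any [t] between [0]
    and [n * u], and a negative shift is the inverse of a positive one. *)
Lemma slowly_decaying_step f (u : R) : 0 < u ->
  positive_on_pos f -> nonincreasing_on_pos f ->
  negligible_wrt (fun x => f x - f (x + u)) f -> slowly_decaying f.
Proof.
move=> u0 f0 fd H.
have H1 : f (x + u) / f x @[x --> +oo] --> (1 : R).
  apply: cvg_ratio1 => // x x0; apply: fd => //; lra.
have Hn n : f (x + n%:R * u) / f x @[x --> +oo] --> (1 : R).
  elim: n => [|n IH].
    apply: cvg_near_cst; near=> x.
    have x0 : 0 < x by near: x; exact: near_pinfty_gt.
    by rewrite mul0r addr0 divff// gt_eqF// f0.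
  have H2 := cvg_comp _ _ (cvg_shift_pinfty (n%:R * u)) H1.
  have : f (x + n%:R * u + u) / f (x + n%:R * u) * (f (x + n%:R * u) / f x)
      @[x --> +oo] --> (1 : R).
    by rewrite -[X in _ --> X](mulr1 1); exact: cvgM H2 IH.
  apply: near_eq_cvg_to.
  near=> x.
  have x0 : 0 < x by near: x; exact: near_pinfty_gt.
  have nu : 0 <= n%:R * u by rewrite mulr_ge0 ?ler0n ?ltW.
  rewrite /= -natr1 mulrDl mul1r addrA.
  have ? : f x != 0 by rewrite gt_eqF ?f0.
  have ? : f (x + n%:R * u) != 0 by rewrite gt_eqF ?f0//; lra.
  by field; apply/andP.
have Hp t : 0 <= t -> f (x + t) / f x @[x --> +oo] --> (1 : R).
  move=> t0; pose n := Num.trunc (t / u).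
  have tn : t <= n.+1%:R * u.
    by rewrite -ler_pdivrMr// ltW// /n truncnS_gt.
  apply: (@squeeze_cvgr _ _ _ _ (fun x => f (x + n.+1%:R * u) / f x) (cst 1));
    [near=> x|exact: Hn|exact: cvg_cst].
  have x0 : 0 < x by near: x; exact: near_pinfty_gt.
  rewrite ler_pdivlMr ?f0// divfK ?gt_eqF ?f0// ler_pdivrMr ?f0// mul1r.
  by apply/andP; split; apply: fd; lra.
move=> t; have [/Hp//|t0] := leP 0 t.
have H2 := cvg_comp _ _ (cvg_shift_pinfty t) (Hp (- t) ltac:(lra)).
have : (f (x + t - t) / f (x + t))^-1 @[x --> +oo] --> (1 : R).
  exact: (cvg1V _ H2).
apply: near_eq_cvg_to; near=> x.
by rewrite /= addrK invf_div.
Unshelve. all: by end_near. Qed.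

Lemma slowly_decaying_equiv f g (c : R) : c != 0 ->
  positive_on_pos f -> positive_on_pos g ->
  f x / g x @[x --> +oo] --> c -> slowly_decaying g -> slowly_decaying f.
Proof.
move=> c0 f0 g0 fg gs t.
have h1 := cvg_comp _ _ (cvg_shift_pinfty t) fg.
have h2 := cvgV c0 fg.
have : f (x + t) / g (x + t) * (g (x + t) / g x) * (f x / g x)^-1
    @[x --> +oo] --> (1 : R).
  have <- : c * 1 * c^-1 = 1 by rewrite mulr1 divff.
  by apply: cvgM; [apply: cvgM; [exact: h1|exact: gs]|exact: h2].
apply: near_eq_cvg_to; near=> x.
have x0 : 0 < x by near: x; exact: near_pinfty_gt.
have xt0 : 0 < x + t.
  by rewrite -ltrBlDr sub0r; near: x; exact: near_pinfty_gt.
have := f0 _ x0; have := g0 _ x0; have := f0 _ xt0; have := g0 _ xt0.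
move=> /= ? ? ? ?; field; repeat (apply/andP; split => //); by rewrite gt_eqF.
Unshelve. all: by end_near. Qed.

Lemma slowly_decaying_gap f (s t : R) :
  positive_on_pos f -> slowly_decaying f ->
  negligible_wrt (fun x => f (x + s) - f (x + t)) f.
Proof.
move=> f0 fs e e0; have h1 := fs s; have h2 := fs t.
have e20 : 0 < e / 2 by lra.
near=> x.
have x0 : 0 < x by near: x; exact: near_pinfty_gt.
have fx := f0 _ x0.
have a1 : `|1 - f (x + s) / f x| <= e / 2.
  by near: x; move/cvgrPdist_le : h1; exact.
have a2 : `|1 - f (x + t) / f x| <= e / 2.
  by near: x; move/cvgrPdist_le : h2; exact.
rewrite -ler_pdivrMr// mulrBl.
move: a1 a2; rewrite !ler_norml => /andP[? ?] /andP[? ?]; lra.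
Unshelve. all: by end_near. Qed.

(** An asymptotic equivalence carries positivity: since [x / 0 = 0], the
    quotient could not tend to 1 if [f] vanished somewhere, and hence
    everywhere further on. *)
Lemma positive_of_asymp_equiv f g : (forall x : R, 0 < x -> 0 <= f x) ->
  nonincreasing_on_pos f -> asymp_equiv f g -> positive_on_pos f.
Proof.
move=> f_ge0 fd fg.
have pos : \forall x \near +oo, 0 < f x.
  have /cvgrPdist_lt /(_ 1 ltr01) H := fg; near=> x.
  have x0 : 0 < x by near: x; exact: near_pinfty_gt.
  rewrite lt_neqAle f_ge0// andbT eq_sym; apply/eqP => fx0.
  have : `|1 - f x / g x| < 1 by near: x.
  by rewrite fx0 mul0r subr0 normr1 ltxx.
move=> x x0; have : \forall y \near +oo, 0 < f y /\ x < y.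
  by apply: filterI => //; exact: near_pinfty_gt.
by move/filter_ex => [y [fy xy]]; rewrite (lt_le_trans fy)// fd// ltW.
Unshelve. all: by end_near. Qed.

End slow_variation.

(** * A tail against its smearing, and against a remainder *)

(** In this section [I x] stands for the integral of [m (y - x)] over [y > x]
    with respect to the measure with tail [G], where the weight [m] increases
    from positive values to [mu]; only the bounds on [I] that such an integral
    satisfies are assumed. *)
Section finite_mean.
Context {R : realType}.
Variables (G I : R -> R) (m : R -> R) (mu : R).
Hypothesis mu0 : 0 < mu.
Hypothesis m0 : forall s : R, 0 < s -> 0 < m s.
Hypothesis m_mu : forall e : R, 0 < e -> exists2 u : R, 0 < u & mu - e <= m u.
Hypothesis G0 : forall x : R, 0 < x -> 0 <= G x.
Hypothesis Gd : nonincreasing_on_pos G.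
Hypothesis I_le : forall x : R, 0 < x -> I x <= mu * G x.
Hypothesis I_ge : forall x u : R, 0 < x -> 0 < u -> m u * G (x + u) <= I x.
Hypothesis I_increment : forall x s t : R, 0 < x -> 0 < s -> s <= t ->
  I (x + t) + m s * (G (x + s) - G (x + t)) <= I x.
Hypothesis I_split : forall x u : R, 0 < x -> 0 < u ->
  I x <= mu * G (x + u) + m u * (G x - G (x + u)).

Lemma positive_of_smeared : positive_on_pos I -> positive_on_pos G.
Proof.
by move=> I1 x x0; rewrite -(pmulr_rgt0 _ mu0) (lt_le_trans (I1 _ x0)) ?I_le.
Qed.

(** The increments of [I] control those of [G], and [I <= mu * G] turns what
    is negligible against [I] into what is negligible against [G]. *)
Lemma slowly_of_smeared : positive_on_pos I -> slowly_decaying I ->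
  slowly_decaying G.
Proof.
move=> I1 Is; have G1 := positive_of_smeared I1.
apply: (@slowly_decaying_step _ G 1) => //.
have m1 : 0 < m 1 by exact: m0.
move=> e e0.
have e1 : 0 < e * m 1 / mu by rewrite divr_gt0 ?mulr_gt0.
have := slowly_decaying_gap I (- 1) 1 I1 Is _ e1 => H; near=> x.
have x1 : 1 < x by near: x; exact: near_pinfty_gt.
have : I (x - 1) - I (x + 1) <= e * m 1 / mu * I x by near: x.
(* The jumps of [po] in [x, x + 1] are seen from [x - 1] at distance at
   least 1, where the weight is at least [m 1]. *)
have /= := @I_increment (x - 1) 1 2 ltac:(lra) ltac:(lra) ltac:(lra).
have -> : x - 1 + 1 = x by ring.
have -> : x - 1 + 2 = x + 1 by ring.
move=> h1 h2.
have h3 : m 1 * (G x - G (x + 1)) <= e * m 1 / mu * I x by lra.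
rewrite -(ler_pM2l m1) (le_trans h3)//.
have -> : m 1 * (e * G x) = e * m 1 / mu * (mu * G x) by field; rewrite gt_eqF.
by rewrite ler_wpM2l ?(ltW e1)// I_le//; lra.
Unshelve. all: by end_near. Qed.

(** Most of the weight is reached at a finite distance [u], and slow decay
    makes [G (x + u)] as good as [G x]. *)
Lemma smeared_equiv : positive_on_pos G -> slowly_decaying G ->
  I x / (mu * G x) @[x --> +oo] --> (1 : R).
Proof.
move=> G1 Gs; apply: cvg_ratio1.
- by move=> x x0; rewrite mulr_gt0 ?G1.
- exact: I_le.
move=> e e0.
have [u u0 mu_u] := @m_mu (mu * (e / 2)) ltac:(by rewrite mulr_gt0//; lra).
have e2 : 0 < e / 2 by lra.
have := slowly_decaying_gap G 0 u G1 Gs _ e2 => H; near=> x.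
have x0 : 0 < x by near: x; exact: near_pinfty_gt.
have h1 : G (x + 0) - G (x + u) <= e / 2 * G x by near: x.
rewrite /= addr0 in h1 *.
have h2 := @I_ge _ _ x0 u0.
have Gx := G1 _ x0.
have Gxu : 0 <= G (x + u) by apply: G0; lra.
have h3 : (mu - mu * (e / 2)) * G (x + u) <= m u * G (x + u).
  by rewrite ler_wpM2r.
have h4 : mu * (G x - G (x + u)) <= mu * (e / 2 * G x).
  by rewrite ler_wpM2l// ltW.
have h5 : mu * (e / 2) * G (x + u) <= mu * (e / 2) * G x.
  rewrite ler_wpM2l ?Gd//; last lra.
  by rewrite mulr_ge0// ltW.
lra.
Unshelve. all: by end_near. Qed.

Lemma equiv_of_slowly : positive_on_pos G -> slowly_decaying G ->
  asymp_equiv G (fun x => mu^-1 * I x).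
Proof.
move=> G1 Gs; rewrite /asymp_equiv.
have H := smeared_equiv G1 Gs.
have : (I x / (mu * G x))^-1 @[x --> +oo] --> (1 : R).
  exact: (cvg1V _ H).
apply: near_eq_cvg_to; near=> x.
by rewrite invf_div invfM invrK mulrCA mulrA.
Unshelve. all: by end_near. Qed.

Lemma smeared_of_slowly : positive_on_pos G -> slowly_decaying G ->
  positive_on_pos I /\ slowly_decaying I.
Proof.
move=> G1 Gs; have I1 : positive_on_pos I.
  move=> x x0; apply: lt_le_trans (@I_ge x 1 x0 ltr01).
  by rewrite mulr_gt0 ?m0// G1//; lra.
split => //.
apply: (@slowly_decaying_equiv _ I G mu) => //; first by rewrite gt_eqF.
have : mu * (I x / (mu * G x)) @[x --> +oo] --> mu.
  rewrite -[X in _ --> X]mulr1; apply: cvgM; first exact: cvg_cst.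
  exact: smeared_equiv.
apply: near_eq_cvg_to; near=> x.
have x0 : 0 < x by near: x; exact: near_pinfty_gt.
have Gx := G1 _ x0.
by field; rewrite !gt_eqF.
Unshelve. all: by end_near. Qed.

(** The weight at distance at most [u] falls short of [mu] by at least
    [mu - m u], so the defect [mu * G - I], negligible by assumption, dominates
    a multiple of the decrease of [G] over [u]. *)
Lemma slowly_of_equiv : (exists2 u : R, 0 < u & m u < mu) ->
  asymp_equiv G (fun x => mu^-1 * I x) ->
  positive_on_pos G /\ slowly_decaying G.
Proof.
move=> [u u0 mu_u] GI.
have G1 := positive_of_asymp_equiv _ _ G0 Gd GI.
split => //; apply: (@slowly_decaying_step _ G u) => //.
move=> e e0.
pose c := mu - m u.
have c0 : 0 < c by rewrite subr_gt0.
have h : I x / (mu * G x) @[x --> +oo] --> (1 : R).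
  have : (G x / (mu^-1 * I x))^-1 @[x --> +oo] --> (1 : R).
    exact: (cvg1V _ GI).
  apply: near_eq_cvg_to; near=> x.
  by rewrite invf_div invfM mulrCA mulrA.
have ec : 0 < e * c / mu by rewrite divr_gt0 ?mulr_gt0.
near=> x.
have x0 : 0 < x by near: x; exact: near_pinfty_gt.
have Gx := G1 _ x0.
have mG : 0 < mu * G x by rewrite mulr_gt0.
have : `|1 - I x / (mu * G x)| <= e * c / mu.
  by near: x; move/cvgrPdist_le : h; exact.
move=> /(le_trans (ler_norm _)); rewrite lerBlDr -lerBlDl ler_pdivlMr// => h1.
have h2 := I_split _ _ x0 u0.
rewrite -(ler_pM2l c0).
have h3 : c * (G x - G (x + u)) <= mu * G x - I x by rewrite /c; lra.
apply: (le_trans h3).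
have -> : c * (e * G x) = e * c / mu * (mu * G x) by field; rewrite gt_eqF.
lra.
Unshelve. all: by end_near. Qed.

End finite_mean.

(** Here [Q] is the tail of the jump measure, [G] that of [po], and [A + r] the
    remainder in Vigon's second identity. *)
Section killed.
Context {R : realType}.
Variables (G Q A r : R -> R) (k : R).
Hypothesis k0 : 0 < k.
Hypothesis G0 : forall x : R, 0 < x -> 0 <= G x.
Hypothesis Gd : nonincreasing_on_pos G.
Hypothesis Qd : nonincreasing_on_pos Q.
Hypothesis A0 : forall x : R, 0 < x -> 0 <= A x.
Hypothesis r0 : forall x : R, 0 < x -> 0 <= r x.
Hypothesis QE : forall x : R, 0 < x -> Q x = A x + r x + k * G x.

Lemma equiv_of_remainder : positive_on_pos G -> negligible_wrt (A \+ r) G ->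
  asymp_equiv G (fun x => k^-1 * Q x).
Proof.
move=> G1 Ar.
have : k * G x / Q x @[x --> +oo] --> (1 : R).
  apply: cvg_ratio1 => x x0.
  - by rewrite QE// ltr_wpDl ?addr_ge0 ?A0 ?r0// mulr_gt0// G1.
  - by rewrite QE// lerDr addr_ge0 ?A0 ?r0.
  have e1 : 0 < x * k by rewrite mulr_gt0.
  have := Ar _ e1 => H; near=> y.
  have y0 : 0 < y by near: y; exact: near_pinfty_gt.
  have H1 : A y + r y <= x * k * G y by near: y.
  rewrite /= QE// addrK (le_trans H1)// -mulrA ler_wpM2l ?(ltW x0)//.
  by rewrite lerDr addr_ge0 ?A0 ?r0.
apply: near_eq_cvg_to; near=> x.
by rewrite invfM invrK mulrCA mulrA.
Unshelve. all: by end_near. Qed.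

Lemma remainder_of_equiv : asymp_equiv G (fun x => k^-1 * Q x) ->
  positive_on_pos G /\ negligible_wrt (A \+ r) G.
Proof.
move=> GQ.
have G1 := positive_of_asymp_equiv _ _ G0 Gd GQ.
split => // e e0.
have h : Q x / (k * G x) @[x --> +oo] --> (1 : R).
  have : (G x / (k^-1 * Q x))^-1 @[x --> +oo] --> (1 : R).
    exact: (cvg1V _ GQ).
  apply: near_eq_cvg_to; near=> x.
  by rewrite invf_div invfM mulrCA mulrA.
have ek : 0 < e / k by rewrite divr_gt0.
near=> x.
have x0 : 0 < x by near: x; exact: near_pinfty_gt.
have Gx := G1 _ x0.
have kG : 0 < k * G x by rewrite mulr_gt0.
have : `|1 - Q x / (k * G x)| <= e / k.
  by near: x; move/cvgrPdist_le : h; exact.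
rewrite distrC => /(le_trans (ler_norm _)).
rewrite lerBlDr ler_pdivrMr// mulrDl mul1r QE//= lerD2r.
have -> // : e / k * (k * G x) = e * G x by field; rewrite gt_eqF.
Unshelve. all: by end_near. Qed.

(** The identity gives [k * G <= Q]; the lower bound by a shifted [Q], with
    [v] close to [1 / k], is the opposite estimate. *)
Lemma equiv_of_renewal : positive_on_pos Q -> slowly_decaying Q ->
  (forall e : R, 0 < e -> exists u v : R, [/\ 0 <= u, 1 - e <= v * k &
     forall x : R, 0 < x -> v * Q (x + u) <= G x]) ->
  asymp_equiv G (fun x => k^-1 * Q x).
Proof.
move=> Q1 Qs H.
have : k * G x / Q x @[x --> +oo] --> (1 : R).
  apply: cvg_ratio1 => // [x x0|e e0].
    by rewrite QE// lerDr addr_ge0 ?A0 ?r0.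
  have e2 : 0 < e / 2 by lra.
  have [u [v [u0 vk vQ]]] := H _ e2.
  have := slowly_decaying_gap Q 0 u Q1 Qs _ e2 => H1; near=> x.
  have x0 : 0 < x by near: x; exact: near_pinfty_gt.
  have h1 : Q (x + 0) - Q (x + u) <= e / 2 * Q x by near: x.
  rewrite /= addr0 in h1 *.
  have h2 : v * k * Q (x + u) <= k * G x.
    by rewrite (mulrC v) -mulrA ler_wpM2l ?vQ// ltW.
  have xu : 0 < x + u by lra.
  have h3 : (1 - e / 2) * Q (x + u) <= v * k * Q (x + u).
    by rewrite ler_wpM2r// ltW// Q1.
  have := Q1 _ xu; have := Q1 _ x0 => p1 p2.
  have h4 : e / 2 * Q (x + u) <= e / 2 * Q x by rewrite ler_wpM2l ?Qd//; lra.
  lra.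
apply: near_eq_cvg_to; near=> x.
by rewrite invfM invrK mulrCA mulrA.
Unshelve. all: by end_near. Qed.

End killed.

(** * Tonelli's theorem for measures that are only known to be sigma-finite *)

Section measure_tools.
Context {R : realType}.
Local Open Scope ereal_scope.

(** The Fubini-Tonelli theory is stated for the structure of sigma-finite
    measures; this attaches that structure to a measure. *)
Lemma sigma_finite_pack d (T : measurableType d)
    (M : {measure set T -> \bar R}) : sigma_finite setT M ->
  exists M' : {sigma_finite_measure set T -> \bar R},
    M = (M' : {measure set T -> \bar R}).
Proof.
move=> sM.
pose h1 := isSFinite.Build _ _ _ _ (sfinite_measure_sigma_finite sM).
pose h2 := isSigmaFinite.Build _ _ _ _ sM.
pose M' := HB.pack_for (SigmaFiniteMeasure.type T R) (Measure.sort M) h1 h2.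
by exists M'; exact: eq_measure.
Qed.

Lemma tonelli_of_sigma_finite d1 d2 (T1 : measurableType d1)
    (T2 : measurableType d2) (M : {measure set T1 -> \bar R})
    (N : {measure set T2 -> \bar R}) (f : T1 * T2 -> \bar R) :
  sigma_finite setT M -> sigma_finite setT N ->
  measurable_fun setT f -> (forall z, 0 <= f z) ->
  \int[M]_x \int[N]_y f (x, y) = \int[N]_y \int[M]_x f (x, y).
Proof.
move=> /sigma_finite_pack[M' ->] /sigma_finite_pack[N' ->] mf f0.
exact: fubini_tonelli.
Qed.

Lemma measurable_section_integral d1 d2 (T1 : measurableType d1)
    (T2 : measurableType d2) (N : {measure set T2 -> \bar R})
    (f : T1 * T2 -> \bar R) : sigma_finite setT N ->
  measurable_fun setT f -> (forall z, 0 <= f z) ->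
  measurable_fun setT (fun x => \int[N]_y f (x, y)).
Proof.
move=> /sigma_finite_pack[N' ->] mf f0.
exact: measurable_fun_fubini_tonelli_F.
Qed.

End measure_tools.

Section tonelli_sets.
Context {R : realType}.
Local Open Scope ereal_scope.

Lemma integral_indic_set d (T : measurableType d)
    (M : {measure set T -> \bar R}) (A : set T) :
  measurable A -> \int[M]_x (\1_A x)%:E = M A.
Proof. by move=> mA; rewrite integral_indic// setIT. Qed.

Lemma tonelli_sets d1 d2 (T1 : measurableType d1) (T2 : measurableType d2)
    (M : {measure set T1 -> \bar R}) (N : {measure set T2 -> \bar R})
    (E : set (T1 * T2)) :
  sigma_finite setT M -> sigma_finite setT N -> measurable E ->
  \int[M]_x N [set y | E (x, y)] = \int[N]_y M [set x | E (x, y)].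
Proof.
move=> sM sN mE.
have mf : measurable_fun setT (fun z => (\1_E z)%:E : \bar R).
  by apply/measurable_EFinP; exact: measurable_indic.
transitivity (\int[M]_x \int[N]_y (\1_E (x, y))%:E).
  apply: eq_integral => x _; rewrite -integral_indic_set//.
  by have := measurable_xsection x mE; rewrite xsectionE.
rewrite (tonelli_of_sigma_finite _ _ _ _ _ _ (fun z => (\1_E z)%:E))//.
apply: eq_integral => y _; rewrite -[RHS]integral_indic_set//.
by have := measurable_ysection y mE; rewrite ysectionE.
Qed.

Lemma measurable_section_measure d1 d2 (T1 : measurableType d1)
    (T2 : measurableType d2) (N : {measure set T2 -> \bar R})
    (E : set (T1 * T2)) : sigma_finite setT N -> measurable E ->
  measurable_fun setT (fun x => N [set y | E (x, y)]).
Proof.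
move=> sN mE.
have mf : measurable_fun setT (fun z => (\1_E z)%:E : \bar R).
  by apply/measurable_EFinP; exact: measurable_indic.
apply: (eq_measurable_fun (fun x => \int[N]_y (\1_E (x, y))%:E)).
  move=> x _; rewrite -[RHS]integral_indic_set//.
  by have := measurable_xsection x mE; rewrite xsectionE.
exact: (measurable_section_integral _ _ _ _ _ (fun z => (\1_E z)%:E)).
Qed.

End tonelli_sets.

(** * Tails of measures on the line *)

Section tails.
Context {R : realType}.
Local Open Scope ereal_scope.
Implicit Types (M N : {measure set (measurableTypeR R) -> \bar R}).

Lemma tail_ge0 M x : 0 <= tail M x.
Proof. exact: measure_ge0. Qed.

Lemma tail_nonincreasing M (x y : R) : (x <= y)%R -> tail M y <= tail M x.
Proof.
move=> xy; apply: le_measure; rewrite ?inE; try exact: measurable_itv.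
by move=> z /=; rewrite !in_itv/= !andbT; exact: le_lt_trans.
Qed.

Lemma tail_split M (x y : R) : (x <= y)%R ->
  tail M x = M `]x, y]%classic + tail M y.
Proof.
move=> xy; rewrite /tail (@itv_bndbnd_setU _ _ (BRight x) (BRight y) +oo%O)//.
rewrite measureU//; apply/seteqP; split => // z /=.
by rewrite !in_itv/= andbT => -[/andP[_ /le_lt_trans]] /[apply]; rewrite ltxx.
Qed.

Lemma integral_ge_cst M (D : set R) (g : R -> R) (c : R) :
  measurable (D : set (measurableTypeR R)) -> (0 <= c)%R ->
  measurable_fun (D : set (measurableTypeR R)) (fun y => (g y)%:E) ->
  (forall y, D y -> (c <= g y)%R) ->
  c%:E * M D <= \int[M]_(y in D) (g y)%:E.
Proof.
move=> mD c0 mg cg; rewrite -integral_cst//.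
exact: ge0_le_integral.
Qed.

Lemma integral_le_cst M (D : set R) (g : R -> R) (c : R) :
  measurable (D : set (measurableTypeR R)) ->
  measurable_fun (D : set (measurableTypeR R)) (fun y => (g y)%:E) ->
  (forall y, D y -> (0 <= g y)%R) ->
  (forall y, D y -> (g y <= c)%R) ->
  \int[M]_(y in D) (g y)%:E <= c%:E * M D.
Proof.
move=> mD mg g0 cg; rewrite -integral_cst//.
exact: ge0_le_integral.
Qed.

Lemma tail_lty_of_integral M (D : set R) (g : R -> R) (x c : R) :
  measurable (D : set (measurableTypeR R)) ->
  measurable_fun (setT : set (measurableTypeR R)) g ->
  `]x, +oo[ `<=` D -> (forall y, D y -> 0 <= g y)%R -> (0 < c)%R ->
  (forall y, x < y -> c <= g y)%R ->
  \int[M]_(y in D) (g y)%:E < +oo -> tail M x < +oo.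
Proof.
move=> mD mg xD g0 c0 cg gD.
have mg' A : measurable_fun (A : set (measurableTypeR R)) (fun y => (g y)%:E).
  by apply: measurable_funTS; exact/measurable_EFinP.
have : c%:E * tail M x < +oo.
  rewrite -integral_cst//=.
  apply: le_lt_trans gD.
  apply: (@le_trans _ _ (\int[M]_(y in `]x, +oo[) (g y)%:E)).
    apply: ge0_le_integral => //.
    - by move=> *; rewrite lee_fin ltW.
    - by move=> y /=; rewrite in_itv/= andbT lee_fin; exact: cg.
  exact: ge0_subset_integral.
have := tail_ge0 M x; case: (tail M x) => [r _ _|_|]//; first by rewrite ltry.
by rewrite gt0_muley ?lte_fin.
Qed.

Lemma sigma_finite_of_tails M : M `]-oo, 0%R]%classic = 0 ->
  (forall x : R, (0 < x)%R -> tail M x < +oo) -> sigma_finite setT M.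
Proof.
move=> M0 Mt.
exists (fun n => `]-oo, 0%R]%classic `|` `](n.+1%:R^-1)%R, +oo[%classic).
  apply/seteqP; split => // x _.
  have [x0|x0] := leP x 0%R.
    by exists 0%N => //; left; rewrite /= in_itv/=.
  exists (Num.trunc (x^-1)%R) => //; right; rewrite /= in_itv/= andbT.
  by rewrite invf_plt ?posrE// truncnS_gt.
move=> n; split; first by apply: measurableU; exact: measurable_itv.
apply: (@le_lt_trans _ _ (M `]-oo, 0%R]%classic + tail M (n.+1%:R^-1)%R)).
  by apply: measureU2; exact: measurable_itv.
by rewrite M0 add0e Mt// invr_gt0.
Qed.

End tails.

Section finite_tails.
Context {R : realType}.
Local Open Scope ereal_scope.
Implicit Types (M N : {measure set (measurableTypeR R) -> \bar R}).

Lemma tail_lty_min M (x : R) :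
  \int[M]_(y in `]0%R, +oo[) (Num.min 1 y)%:E < +oo -> (0 < x)%R ->
  tail M x < +oo.
Proof.
move=> Mlty x0;
apply: (tail_lty_of_integral M _ (fun y => Num.min 1 y)%R x (Num.min 1 x)%R
  _ _ _ _ _ _ Mlty).
- exact: measurable_itv.
- exact: measurable_minr.
- by move=> y /=; rewrite !in_itv/= !andbT; exact: lt_trans.
- by move=> y /=; rewrite in_itv/= andbT le_min ler01 => /ltW.
- by rewrite lt_min ltr01.
- by move=> y xy; rewrite le_min2// ltW.
Qed.

Lemma tail_lty_min_sqr M (x : R) :
  \int[M]_y (Num.min 1 (y ^+ 2))%:E < +oo -> (0 < x)%R -> tail M x < +oo.
Proof.
move=> Mlty x0;
apply: (tail_lty_of_integral M _ (fun y => Num.min 1 (y ^+ 2))%R x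
  (Num.min 1 (x ^+ 2))%R _ _ _ _ _ _ Mlty) => //.
- by apply: measurable_minr => //; exact: exprn_measurable.
- by move=> y _; rewrite le_min ler01 sqr_ge0.
- by rewrite lt_min ltr01 exprn_gt0.
- move=> y xy; apply: le_min2 => //.
  by rewrite lerXn2r ?nnegrE ?(ltW x0)// ltW// (lt_trans x0).
Qed.

Lemma ex_tail_gt0 M : 0 < M `]0%R, +oo[%classic ->
  exists2 v : R, (0 < v)%R & 0 < tail M v.
Proof.
move=> M0; apply: contrapT => H.
have {}H v : (0 < v)%R -> tail M v = 0.
  move=> v0; apply/eqP; rewrite eq_le tail_ge0 andbT leNgt.
  by apply/negP => ?; apply: H; exists v.
move: M0; suff -> : M `]0%R, +oo[%classic = 0 by rewrite ltxx.
have inv0 n : (0 < n.+1%:R^-1 :> R)%R by rewrite invr_gt0.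
have E : `]0%R, +oo[%classic = \bigcup_n `](n.+1%:R^-1 : R)%R, +oo[%classic.
  apply/seteqP; split => [y /=|y [n _] /=]; rewrite !in_itv/= !andbT => y0.
    exists (Num.trunc y^-1) => //=; rewrite in_itv/= andbT.
    by rewrite invf_plt ?posrE// truncnS_gt.
  exact: lt_trans (inv0 n) y0.
apply: measure_negligible => //; rewrite E.
by apply: negligible_bigcup => n; apply/negligibleP => //; exact: H.
Qed.

Lemma tail_vanishes M : (forall x : R, (0 < x)%R -> tail M x < +oo) ->
  forall e : R, (0 < e)%R -> exists2 K : R, (1 <= K)%R & tail M K <= e%:E.
Proof.
move=> Mfin e e0.
have : tail M n.+1%:R @[n --> \oo] -->
    M (\bigcap_n `](n.+1%:R : R), +oo[%classic).
  apply: nonincreasing_cvg_mu => //.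
  - exact: Mfin.
  - by apply: bigcapT_measurable => n; exact: measurable_itv.
  - move=> n m nm; apply/subsetPset => y /=; rewrite !in_itv/= !andbT.
    by apply: le_lt_trans; rewrite ler_nat.
rewrite (_ : \bigcap_n _ = set0); last first.
  apply/seteqP; split => // y /(_ (Num.trunc y) I) /=.
  by rewrite in_itv/= andbT ltNge (ltW (truncnS_gt _)).
rewrite measure0 => /fine_cvgP[fin /cvgrPdist_le/(_ _ e0) H].
have : \forall n \near \oo, tail M n.+1%:R <= e%:E.
  near=> n.
  have fn : tail M n.+1%:R \is a fin_num by near: n.
  rewrite -(fineK fn) lee_fin.
  have : (`|0 - fine (tail M n.+1%:R)| <= e)%R by near: n.
  by rewrite sub0r normrN ger0_norm// fine_ge0// tail_ge0.
move=> [n _ /(_ n (leqnn n))] ?; exists n.+1%:R => //.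
by rewrite ler1n.
Unshelve. all: by end_near. Qed.

End finite_tails.

(** * Smeared tails *)

Section smeared_tail.
Context {R : realType}.
Local Open Scope ereal_scope.
Variables (M : {measure set (measurableTypeR R) -> \bar R}) (m : R -> R).
Variable mu : R.
Hypothesis m_nd : {homo m : x y / (x <= y)%R}.
Hypothesis m0 : forall u : R, (0 <= m u)%R.
Hypothesis m_mu : forall u : R, (m u <= mu)%R.

Definition smeared (x : R) : \bar R :=
  \int[M]_(y in `]x, +oo[) (m (y - x))%:E.

Let mm x D : measurable_fun (D : set (measurableTypeR R))
  (fun y : R => (m (y - x))%:E).
Proof.
apply: measurable_funTS; apply/measurable_EFinP.
apply: nondecreasing_measurable => //= y z yz; apply: m_nd; lra.
Qed.

Lemma smeared_le x : smeared x <= mu%:E * tail M x.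
Proof. by apply: integral_le_cst => //; exact: measurable_itv. Qed.

Lemma smeared_setU (x y : R) : (x <= y)%R -> smeared x =
  \int[M]_(z in `]x, y]) (m (z - x))%:E +
  \int[M]_(z in `]y, +oo[) (m (z - x))%:E.
Proof.
move=> xy.
rewrite /smeared (@itv_bndbnd_setU _ _ (BRight x) (BRight y) +oo%O)//.
rewrite ge0_integral_setU//=; try exact: measurable_itv.
- by move=> *; rewrite lee_fin.
- apply/disj_setPS => z [] /=; rewrite !in_itv/= andbT => /andP[_ zy] yz.
  by have := lt_le_trans yz zy; rewrite ltxx.
Qed.

Lemma smeared_ge (x u : R) : (0 <= u)%R ->
  (m u)%:E * tail M (x + u)%R <= smeared x.
Proof.
move=> u0; rewrite (@smeared_setU x (x + u)%R) ?lerDl//.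
rewrite -[leLHS]add0e; apply: leeD.
  by apply: integral_ge0 => *; rewrite lee_fin.
apply: integral_ge_cst => //.
by move=> y /=; rewrite in_itv/= andbT => xy; apply: m_nd; lra.
Qed.

(** Beyond [x + t] the weight seen from [x] exceeds the one seen from [x + t];
    the mass in between is seen from [x] with weight at least [m s]. *)
Lemma smeared_increment (x s t : R) : (0 <= s)%R -> (s <= t)%R ->
  smeared (x + t)%R + (m s)%:E * M `](x + s)%R, (x + t)%R]%classic
    <= smeared x.
Proof.
move=> s0 st; rewrite [leRHS](@smeared_setU x (x + t)%R); last lra.
rewrite [leRHS]addeC; apply: leeD; last first.
  apply: (@le_trans _ _
    (\int[M]_(z in `](x + s)%R, (x + t)%R]) (m (z - x))%:E)).
    apply: integral_ge_cst => //.
    by move=> y /=; rewrite in_itv/= => /andP[xy _]; apply: m_nd; lra.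
  apply: ge0_subset_integral => //=.
  - by move=> *; rewrite lee_fin.
  - move=> y /=; rewrite !in_itv/= => /andP[xy ->]; rewrite andbT; lra.
apply: ge0_le_integral => //=.
- by move=> *; rewrite lee_fin.
- by move=> y _; rewrite lee_fin m_nd//; lra.
Qed.

Lemma smeared_le_split (x u : R) : (0 <= u)%R ->
  smeared x <= mu%:E * tail M (x + u)%R
    + (m u)%:E * M `]x, (x + u)%R]%classic.
Proof.
move=> u0; rewrite (@smeared_setU x (x + u)%R); last lra.
rewrite [leRHS]addeC; apply: leeD; apply: integral_le_cst => //.
- by move=> y /=; rewrite in_itv/= => /andP[_ xy]; apply: m_nd; lra.
Qed.

End smeared_tail.

(** * Overshoots *)

Section overshoot.
Context {R : realType}.
Local Open Scope ereal_scope.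
Implicit Types (M N : {measure set (measurableTypeR R) -> \bar R}).

Let T2 := (measurableTypeR R * measurableTypeR R)%type.

Lemma measurable_lt_pair (f g : T2 -> R) : measurable_fun setT f ->
  measurable_fun setT g -> measurable [set z | (f z < g z)%R].
Proof.
move=> mf mg.
rewrite (_ : [set z | _] = (fun z => f z - g z)%R @^-1` `]-oo, 0%R[).
  by rewrite -[X in measurable X]setTI; apply: measurable_funB.
by apply/seteqP; split => z /=; rewrite in_itv/= subr_lt0.
Qed.

(** The integral in Vigon's second identity: the measure, in the product of
    [M] and [N], of the pairs [(y, s)] such that [x < y < x + s]. *)
Definition overshoot M N (x : R) : \bar R :=
  \int[M]_(y in `]x, +oo[) tail N (y - x)%R.

Let kernel N (z : T2) : \bar R :=
  (\1_[set z : T2 | (z.1 < z.2)%R] z)%:E * tail N (z.2 - z.1).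

Let measurable_kernel N : measurable_fun setT (kernel N).
Proof.
apply: emeasurable_funM.
  by apply/measurable_EFinP/measurable_indic; exact: measurable_lt_pair.
by apply: (measurableT_comp (measurable_tail N)); exact: measurable_funB.
Qed.

Let kernel_ge0 N z : 0 <= kernel N z.
Proof. by rewrite mule_ge0// ?tail_ge0// lee_fin. Qed.

Let kernelE N z y : kernel N (z, y) = if (z < y)%R then tail N (y - z) else 0.
Proof.
rewrite /kernel indicE; case: ifPn => zy; first by rewrite mem_set ?mul1e.
by rewrite memNset ?mul0e//=; exact/negP.
Qed.

Let overshoot_kernel M N z : overshoot M N z = \int[M]_y kernel N (z, y).
Proof.
rewrite /overshoot integral_mkcond; apply: eq_integral => y _.
by rewrite patchE kernelE mem_setE in_itv/= andbT.
Qed.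

Lemma measurable_overshoot M N : sigma_finite setT M ->
  measurable_fun setT (overshoot M N).
Proof.
move=> sM; apply: (eq_measurable_fun (fun z => \int[M]_y kernel N (z, y))).
  by move=> z _; rewrite overshoot_kernel.
exact: measurable_section_integral.
Qed.

Lemma overshootE M N (x : R) : sigma_finite setT M -> sigma_finite setT N ->
  overshoot M N x = \int[N]_s M `]x, (x + s)%R[%classic.
Proof.
move=> sM sN.
pose E : set T2 := [set z | (x < z.1)%R] `&` [set z | (z.1 < x + z.2)%R].
have mE : measurable E.
  apply: measurableI; apply: measurable_lt_pair => //.
  exact: measurable_funD.
transitivity (\int[M]_y N [set s | E (y, s)]); last first.
  rewrite tonelli_sets//; apply: eq_integral => s _; congr (M _).
  by apply/seteqP; split => y /=; rewrite in_itv /E/= => /andP.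
rewrite /overshoot integral_mkcond.
apply: eq_integral => y _; rewrite patchE.
have [|] := boolP (y \in _).
  rewrite inE/= in_itv/= andbT => xy; congr (N _).
  apply/seteqP; split => s /=; rewrite in_itv /E/= andbT => H.
    by split => //; lra.
  by case: H; lra.
rewrite notin_setE/= in_itv/= andbT => xy.
rewrite (_ : [set s | _] = set0) ?measure0//.
by apply/seteqP; split => s //= [].
Qed.

Lemma cap_length (x y s : R) : (@lebesgue_measure R)
  [set z | [/\ (x < z)%R, (z < y)%R & (y < z + s)%R]] =
  (Num.max 0 (Num.min s (y - x)))%:E.
Proof.
rewrite (_ : [set z | _] = `](Num.max x (y - s))%R, y[%classic); last first.
  apply/seteqP; split => z /=; rewrite in_itv/= gt_max.
    by move=> [-> -> ?]; rewrite !andbT; lra.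
  by move=> /andP[/andP[-> ?] ->]; split => //; lra.
rewrite lebesgue_measure_itv/= lte_fin gt_max.
have [xy|xy] := ltP x y; have [s0|s0] := ltP 0%R s => /=.
- have -> : (y - s < y)%R by lra.
  rewrite -EFinD; congr EFin; rewrite /Num.max /Num.min.
  by repeat case: ifPn; rewrite -?leNgt; lra.
- have -> : (y - s < y)%R = false by apply/negbTE; rewrite -leNgt; lra.
  congr EFin; rewrite /Num.max /Num.min.
  by repeat case: ifPn; rewrite -?leNgt; lra.
- congr EFin; rewrite /Num.max /Num.min.
  by repeat case: ifPn; rewrite -?leNgt; lra.
- congr EFin; rewrite /Num.max /Num.min.
  by repeat case: ifPn; rewrite -?leNgt; lra.
Qed.

(** The maximum with 0 makes the integrand the length of an interval, also when
    [s] or [u] is negative: see [cap_length]. *)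
Definition capped_mean N (u : R) : \bar R :=
  \int[N]_s (Num.max 0 (Num.min s u))%:E.

(** For fixed [y] and [s], the set of [z > x] such that [z < y < z + s] is an
    interval of length [min s (y - x)]. *)
Lemma integral_overshoot M N (x : R) :
  sigma_finite setT M -> sigma_finite setT N ->
  \int[lebesgue_measure]_(z in `]x, +oo[) overshoot M N z =
  \int[M]_(y in `]x, +oo[) capped_mean N (y - x).
Proof.
move=> sM sN.
have sL : sigma_finite setT (@lebesgue_measure R).
  exact: sigma_finiteT.
pose f (z : T2) : \bar R := (\1_[set z : T2 | (x < z.1)%R] z)%:E * kernel N z.
have mf : measurable_fun setT f.
  apply: emeasurable_funM => //.
  by apply/measurable_EFinP/measurable_indic; exact: measurable_lt_pair.
have f0 z : 0 <= f z by rewrite mule_ge0// lee_fin.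
have fE z y : f (z, y) = if (x < z)%R then kernel N (z, y) else 0.
  rewrite /f indicE; case: ifPn => xz; first by rewrite mem_set ?mul1e.
  by rewrite memNset ?mul0e//=; exact/negP.
transitivity (\int[lebesgue_measure]_z \int[M]_y f (z, y)).
  rewrite integral_mkcond; apply: eq_integral => z _.
  rewrite patchE mem_setE in_itv/= andbT; case: ifPn => xz.
    rewrite overshoot_kernel; apply: eq_integral => y _.
    by rewrite fE xz.
  by rewrite integral0_eq// => y _; rewrite fE (negbTE xz).
rewrite (tonelli_of_sigma_finite _ _ _ _ _ _ f)//.
rewrite [RHS]integral_mkcond; apply: eq_integral => y _; rewrite patchE.
transitivity (capped_mean N (y - x)); last first.
  case: ifPn => //; rewrite notin_setE/= in_itv/= andbT => /negP xy.
  rewrite /capped_mean integral0_eq// => s _; congr EFin.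
  rewrite /Num.max /Num.min; move: xy; rewrite -leNgt => xy.
  by repeat case: ifPn; rewrite -?leNgt; lra.
pose E : set T2 := [set z | [/\ (x < z.1)%R, (z.1 < y)%R & (y < z.1 + z.2)%R]].
have mE : measurable E.
  rewrite (_ : E = [set z : T2 | (x < z.1)%R] `&`
      [set z : T2 | (z.1 < y)%R] `&` [set z : T2 | (y < z.1 + z.2)%R]).
    apply: measurableI; first apply: measurableI;
      apply: measurable_lt_pair => //.
    exact: measurable_funD.
  by apply/seteqP; split => z [] //= [].
transitivity (\int[lebesgue_measure]_z N [set s | E (z, s)]).
  apply: eq_integral => z _; rewrite fE kernelE (_ : (if _ then _ else _) =
    if (x < z)%R && (z < y)%R then tail N (y - z) else 0); last by case: ifP.
  case: ifPn => [/andP[xz zy]|H].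
    congr (N _); apply/seteqP; split => s /=.
      by rewrite in_itv/= andbT /E/= => ?; split => //; lra.
    by rewrite in_itv/= andbT /E/= => -[_ _ ?]; lra.
  rewrite (_ : [set s | _] = set0) ?measure0//.
  by apply/seteqP; split => // s [/= xz zy _]; rewrite xz zy in H.
rewrite tonelli_sets//; apply: eq_integral => s _.
exact: cap_length.
Qed.

End overshoot.

Section small_jumps.
Context {R : realType}.
Local Open Scope ereal_scope.
Variables M N : {measure set (measurableTypeR R) -> \bar R}.
Hypothesis sM : sigma_finite setT M.
Hypothesis sN : sigma_finite setT N.

Lemma measurable_mass_oc (c x : R) :
  measurable_fun setT (fun s : measurableTypeR R => M `]c, (x + s)%R]%classic).
Proof.
pose E : set (measurableTypeR R * measurableTypeR R) :=
  [set z | (c < z.2)%R] `&` ~` [set z | (x + z.1 < z.2)%R].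
have mE : measurable E.
  apply: measurableI; last apply: measurableC; apply: measurable_lt_pair => //.
  exact: measurable_funD.
apply: eq_measurable_fun (measurable_section_measure _ _ _ _ M E sM mE).
move=> s _; congr (M _); apply/seteqP; split => y /=; rewrite in_itv/= /E/=.
  by move=> [-> /negP]; rewrite -leNgt.
by move=> /andP[-> ?]; split => //; apply/negP; rewrite -leNgt.
Qed.

Lemma measurable_mass_oo (c x : R) :
  measurable_fun setT (fun s : measurableTypeR R => M `]c, (x + s)%R[%classic).
Proof.
pose E : set (measurableTypeR R * measurableTypeR R) :=
  [set z | (c < z.2)%R] `&` [set z | (z.2 < x + z.1)%R].
have mE : measurable E.
  apply: measurableI; apply: measurable_lt_pair => //.
  exact: measurable_funD.
apply: eq_measurable_fun (measurable_section_measure _ _ _ _ M E sM mE).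
move=> s _; congr (M _); apply/seteqP.
by split => y /=; rewrite in_itv/= /E/= => /andP.
Qed.

Lemma le_measure_itv (i j : interval R) : [set` i] `<=` [set` j] ->
  M [set` i] <= M [set` j].
Proof.
by move=> ij; apply: le_measure; rewrite ?inE//; exact: measurable_itv.
Qed.

(** Jumps [s] of size at most 1 are kept; those in [1, K] reach at most
    [x + K], and those beyond [K] are rare. *)
Lemma overshoot_le (x K : R) : (1 <= K)%R ->
  overshoot M N x <= \int[N]_(s in `[0%R, 1%R]) M `]x, (x + s)%R]%classic
    + tail N 1%R * M `]x, (x + K)%R]%classic + tail N K * tail M x.
Proof.
move=> K1; rewrite overshootE//.
have m0 D : measurable_fun (D : set (measurableTypeR R))
    (fun s => M `]x, (x + s)%R[%classic).
  by apply: measurable_funTS; exact: measurable_mass_oo.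
have m1 D : measurable_fun (D : set (measurableTypeR R))
    (fun s => M `]x, (x + s)%R]%classic).
  by apply: measurable_funTS; exact: measurable_mass_oc.
rewrite (_ : [set: measurableTypeR R] =
  `]-oo, 0%R[%classic `|` `[0%R, 1%R] `|` `]1%R, K] `|` `]K, +oo[); last first.
  apply/seteqP; split => // s _ /=; rewrite !in_itv/= andbT.
  have [s0|s0] := ltP s 0%R; first by left; left; left.
  have [s1|s1] := leP s 1%R; first by left; left; right.
  have [sK|sK] := leP s K; first by left; right.
  by right.
rewrite !ge0_integral_setU//=; last 5 first.
- apply/disj_setPS => s [] /=; rewrite !in_itv/= => ? /andP[? ?]; lra.
- exact: measurableU.
- apply/disj_setPS => s [[|]] /=; rewrite !in_itv/=;
    [move=> ?|move=> /andP[? ?]];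
    move=> /andP[? ?]; lra.
- by apply: measurableU => //; exact: measurableU.
- apply/disj_setPS => s [[[]|]] /=; rewrite !in_itv/= andbT;
    [move=> ?|move=> /andP[? ?]|move=> /andP[? ?]]; move=> ?; lra.
rewrite integral0_eq ?add0e; last first.
  move=> s /=; rewrite in_itv/= => s0; rewrite set_itv_ge ?measure0//.
  by rewrite bnd_simp -leNgt; lra.
apply: leeD; first apply: leeD.
- apply: ge0_le_integral => // s _; apply: le_measure_itv.
  by move=> y /=; rewrite !in_itv/= => /andP[-> /ltW ->].
- apply: (@le_trans _ _
    (\int[N]_(s in `]1%R, K]) cst (M `]x, (x + K)%R]%classic) s)).
    apply: ge0_le_integral => // s /=; rewrite in_itv/= => /andP[s1 sK].
    apply: le_measure_itv => y /=.
    rewrite !in_itv/= => /andP[-> /ltW ys]/=; lra.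
  rewrite integral_cst//= muleC lee_wpmul2r//.
  apply: le_measure; rewrite ?inE//; try exact: measurable_itv.
  by move=> y /=; rewrite !in_itv/= andbT => /andP[].
- apply: (@le_trans _ _ (\int[N]_(s in `]K, +oo[) cst (tail M x) s)).
    apply: ge0_le_integral => // s _; apply: le_measure_itv.
    by move=> y /=; rewrite !in_itv/= => /andP[->].
  by rewrite integral_cst//= muleC.
Qed.

(** An overshoot over [x] integrates the mass of the open interval
    [x < y < x + s], whereas here the end point [x + s] is included, and it may
    be an atom. Moving [x] to the right by [h > 0] lets the open interval from
    [x + h] contain that end point, and [h] then decreases to 0. *)
Lemma small_jumps_le (x : R) (C : \bar R) :
  (forall y : R, (x < y)%R -> overshoot M N y <= C) ->
  \int[N]_(s in `[0%R, 1%R]) M `]x, (x + s)%R]%classic <= C.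
Proof.
move=> oC.
pose g n (s : R) := M `](x + n.+1%:R^-1)%R, (x + s)%R]%classic.
have mg n D : measurable_fun (D : set (measurableTypeR R)) (g n).
  by apply: measurable_funTS; exact: measurable_mass_oc.
have inv0 n : (0 < n.+1%:R^-1 :> R)%R by rewrite invr_gt0.
have gnd s : nondecreasing_seq (g ^~ s).
  move=> n m nm; apply: le_measure_itv => y /=; rewrite !in_itv/=.
  move=> /andP[xy ->]; rewrite andbT; apply: le_lt_trans xy.
  by rewrite lerD2l lef_pV2 ?posrE// ler_nat.
have gcvg s : g n s @[n --> \oo] --> M `]x, (x + s)%R]%classic.
  rewrite (_ : `]x, (x + s)%R]%classic =
    \bigcup_n `](x + n.+1%:R^-1)%R, (x + s)%R]%classic); last first.
    apply/seteqP; split => [y /=|y [n _] /=]; rewrite in_itv/= => /andP[xy ys].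
      exists (Num.trunc (y - x)^-1) => //=; rewrite in_itv/= ys andbT.
      rewrite -ltrBrDl invf_plt ?posrE ?subr_gt0//.
      exact: truncnS_gt.
    by rewrite in_itv/= ys andbT; apply: lt_trans xy; rewrite ltrDl.
  apply: nondecreasing_cvg_mu => //.
    by apply: bigcupT_measurable => n; exact: measurable_itv.
  move=> n m nm; apply/subsetPset => y /=; rewrite !in_itv/=.
  move=> /andP[xy ->]; rewrite andbT; apply: le_lt_trans xy.
  by rewrite lerD2l lef_pV2 ?posrE// ler_nat.
rewrite (_ : \int[N]_(s in _) _ =
  limn (fun n => \int[N]_(s in `[0%R, 1%R]) g n s)).
  apply: lime_le.
    apply: ereal_nondecreasing_is_cvgn => n m nm.
    by apply: ge0_le_integral => // s _; exact: gnd.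
  apply: nearW => n.
  apply: le_trans (oC (x + n.+1%:R^-1)%R _); last by rewrite ltrDl.
  rewrite overshootE//.
  apply: (@le_trans _ _ (\int[N]_s g n s)).
    exact: ge0_subset_integral.
  apply: ge0_le_integral => //.
    exact: measurable_mass_oo.
  move=> s _; apply: le_measure_itv => y /=.
  rewrite !in_itv/= => /andP[-> ys]/=.
  by apply: le_lt_trans ys _; rewrite addrAC ltrDl.
rewrite -monotone_convergence//.
by apply: eq_integral => s _; apply/esym/cvg_lim.
Qed.

End small_jumps.

(** * Truncated means *)

Section capped_mean.
Context {R : realType}.
Local Open Scope ereal_scope.
Variable N : {measure set (measurableTypeR R) -> \bar R}.

Let mcap (u : R) D : measurable_fun (D : set (measurableTypeR R))
  (fun s : R => (Num.max 0 (Num.min s u))%:E).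
Proof.
apply: measurable_funTS; apply/measurable_EFinP.
by apply: measurable_maxr => //; exact: measurable_minr.
Qed.

Let mpos D : measurable_fun (D : set (measurableTypeR R))
  (fun s : R => (Num.max 0 s)%:E).
Proof.
by apply: measurable_funTS; apply/measurable_EFinP; exact: measurable_maxr.
Qed.

Lemma capped_mean_ge0 u : 0 <= capped_mean N u.
Proof. by apply: integral_ge0 => s _; rewrite lee_fin le_max lexx. Qed.

Lemma capped_mean_nd (u v : R) : (u <= v)%R ->
  capped_mean N u <= capped_mean N v.
Proof.
move=> uv; apply: ge0_le_integral => //.
- by move=> s _; rewrite lee_fin le_max lexx.
- by move=> s _; rewrite lee_fin le_max2// le_min2.
Qed.

Lemma integral_idE :
  \int[N]_(s in `]0%R, +oo[) s%:E = \int[N]_s (Num.max 0 s)%:E.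
Proof.
rewrite integral_mkcond; apply: eq_integral => s _; rewrite patchE.
rewrite mem_setE in_itv/= andbT; case: ifPn => [s0|].
  by rewrite max_r// ltW.
by rewrite -leNgt => s0; rewrite max_l.
Qed.

Lemma capped_mean_le u : capped_mean N u <= \int[N]_(s in `]0%R, +oo[) s%:E.
Proof.
rewrite integral_idE; apply: ge0_le_integral => //.
- by move=> s _; rewrite lee_fin le_max lexx.
- by move=> s _; rewrite lee_fin le_max2// ge_min lexx.
Qed.

Lemma cvg_capped_mean :
  capped_mean N n%:R @[n --> \oo] --> \int[N]_(s in `]0%R, +oo[) s%:E.
Proof.
rewrite integral_idE (_ : \int[N]_s _ =
    \int[N]_s limn (fun n => (Num.max 0 (Num.min s n%:R))%:E)).
  apply: (@cvg_monotone_convergence _ _ _ N setT measurableT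
    (fun n s => (Num.max 0 (Num.min s n%:R))%:E)).
  - by move=> n; exact: mcap.
  - by move=> n s _; rewrite lee_fin le_max lexx.
  - by move=> s _ n m nm; rewrite lee_fin le_max2// le_min2// ler_nat.
apply: eq_integral => s _; apply/esym/cvg_lim => //.
apply: cvg_near_cst; exists (Num.trunc s).+1 => // n /= sn.
rewrite min_l// ltW// (lt_le_trans (truncnS_gt s))// ler_nat//.
Qed.

Lemma capped_mean_ge (u v : R) : (0 < u)%R -> (0 < v)%R ->
  (Num.min u v)%:E * tail N v <= capped_mean N u.
Proof.
move=> u0 v0.
apply: (@le_trans _ _ (\int[N]_(s in `]v, +oo[) (Num.max 0 (Num.min s u))%:E)).
  apply: integral_ge_cst => //.
  - by rewrite le_min !ltW.
  - move=> s /=; rewrite in_itv/= andbT => vs.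
    by rewrite le_max minC le_min2 ?orbT// ltW.
apply: ge0_subset_integral => //.
by move=> s _; rewrite lee_fin le_max lexx.
Qed.

(** A jump beyond [v] exceeds its truncation at [u] by at least [v - u]. *)
Lemma capped_mean_gap (u v : R) : (0 < u)%R -> (u <= v)%R ->
  capped_mean N u + (v - u)%:E * tail N v <= \int[N]_(s in `]0%R, +oo[) s%:E.
Proof.
move=> u0 uv.
pose ind (s : R) : \bar R := (\1_(`]v, +oo[%classic : set R) s)%:E.
have mind : measurable_fun (setT : set (measurableTypeR R)) ind.
  by apply/measurable_EFinP; exact: measurable_indic.
have vu0 : 0 <= (v - u)%:E by rewrite lee_fin subr_ge0.
have -> : tail N v = \int[N]_s ind s by rewrite integral_indic_set.
have cap0 (s : R) : 0 <= (Num.max 0 (Num.min s u))%:E.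
  by rewrite lee_fin le_max lexx.
have ind0 s : 0 <= (v - u)%:E * ind s by rewrite mule_ge0// lee_fin.
have mvind : measurable_fun setT (fun s => (v - u)%:E * ind s).
  exact: measurable_funeM.
rewrite -ge0_integralZl//; last by move=> s _; rewrite lee_fin.
rewrite integral_idE -ge0_integralD//.
apply: ge0_le_integral => //.
- by move=> s _; exact: adde_ge0.
- exact: emeasurable_funD.
move=> s _; rewrite -EFinM -EFinD lee_fin indicE mem_setE in_itv/= andbT.
have [vs|vs] := ltP v s.
  by rewrite mulr1 min_r; [rewrite !max_r; lra|lra].
by rewrite mulr0 addr0 le_max2// ge_min lexx.
Qed.

End capped_mean.

(** * The mean of a subordinator *)

Section dyadic_difference_quotient.
Context {R : realType}.

Definition dyadic (n : nat) : R := 2^-1 ^+ n.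

(** The difference quotient at 0 of [l |-> 1 - expR (- (l * x))]. Along dyadic
    [l] it is monotone for an elementary reason, and monotone convergence then
    differentiates Laplace transforms under the integral sign. *)
Definition exp_quotient (n : nat) (x : R) : R :=
  (1 - expR (- (dyadic n * x))) / dyadic n.

Lemma dyadic_gt0 n : 0 < dyadic n. Proof. by rewrite exprn_gt0//; lra. Qed.

Lemma dyadic_le1 n : dyadic n <= 1.
Proof. by apply: exprn_ile1; lra. Qed.

Lemma cvg_dyadic : dyadic n @[n --> \oo] --> (0 : R).
Proof. by apply: cvg_expr; rewrite ger0_norm; lra. Qed.

Lemma exp_quotient_ge0 n x : 0 <= x -> 0 <= exp_quotient n x.
Proof.
move=> x0; rewrite divr_ge0 ?(ltW (dyadic_gt0 n))// subr_ge0.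
by rewrite -[leRHS]expR0 ler_expR oppr_le0 mulr_ge0// ltW// dyadic_gt0.
Qed.

(** With [a = expR (- l x)], halving [2 * l] compares [(1 - a ^+ 2) / 2] with
    [1 - a]. *)
Lemma exp_quotient_step n x : exp_quotient n x <= exp_quotient n.+1 x.
Proof.
rewrite /exp_quotient; have d0 := dyadic_gt0 n.+1.
have -> : dyadic n = 2 * dyadic n.+1.
  by rewrite /dyadic exprS mulrA divff ?mul1r// pnatr_eq0.
set l := dyadic n.+1 in d0 *.
rewrite ler_pdivlMr// (_ : - (2 * l * x) = - (l * x) + - (l * x)); last by ring.
rewrite expRD; set a := expR _.
have -> : (1 - a * a) / (2 * l) * l = (1 - a * a) / 2 by field; rewrite gt_eqF.
have := sqr_ge0 (1 - a); rewrite expr2; lra.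
Qed.

Lemma exp_quotient_nd x : nondecreasing_seq (exp_quotient ^~ x).
Proof. by apply/nondecreasing_seqP => n; exact: exp_quotient_step. Qed.

Lemma exp_quotient_le n x : exp_quotient n x <= x.
Proof.
rewrite ler_pdivrMr ?dyadic_gt0// [leRHS]mulrC.
by have := expR_ge1Dx (- (dyadic n * x)); lra.
Qed.

Lemma exp_quotient_ge n x : 0 <= x ->
  x / (1 + dyadic n * x) <= exp_quotient n x.
Proof.
move=> x0; have d0 := dyadic_gt0 n; set l := dyadic n in d0 *.
have lx : 0 <= l * x by rewrite mulr_ge0// ltW.
rewrite ler_pdivrMr; last lra.
rewrite mulrAC ler_pdivlMr//.
rewrite -/l expRN; set E := expR _.
have E1 : 1 + l * x <= E by exact: expR_ge1Dx.
have E0 : 0 < E by rewrite expR_gt0.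
have : E^-1 * (1 + l * x) <= 1 by rewrite mulrC ler_pdivrMr ?mul1r.
lra.
Qed.

Lemma cvg_exp_quotient x : 0 <= x ->
  exp_quotient n x @[n --> \oo] --> x.
Proof.
move=> x0.
apply: (@squeeze_cvgr _ _ _ _ (fun n => x / (1 + dyadic n * x)) (cst x)).
- by apply: nearW => n; rewrite exp_quotient_ge//= exp_quotient_le.
- have h0 : dyadic n * x @[n --> \oo] --> (0 : R).
    rewrite -[X in _ --> X](mul0r x).
    by apply: cvgM; [exact: cvg_dyadic|exact: cvg_cst].
  have h1 : 1 + dyadic n * x @[n --> \oo] --> (1 : R).
    by rewrite -[X in _ --> X]addr0; apply: cvgD; [exact: cvg_cst|].
  rewrite -[X in _ --> X]mulr1 -[X in _ * X]invr1.
  by apply: cvgM; [exact: cvg_cst|exact: cvgV (oner_neq0 _) h1].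
- exact: cvg_cst.
Qed.

Lemma measurable_exp_quotient n (D : set R) : measurable_fun D (exp_quotient n).
Proof.
apply: measurable_funTS; apply: measurable_funM; last exact: measurable_cst.
apply: measurable_funB; first exact: measurable_cst.
apply: measurableT_comp; first exact: measurable_expR.
exact: measurableT_comp.
Qed.

End dyadic_difference_quotient.

Section mean.
Context {R : realType}.
Local Open Scope ereal_scope.

Lemma cvg_integral_exp_quotient d (T : measurableType d)
    (M : {measure set T -> \bar R}) (D : set T) (X : T -> R) :
  measurable D -> measurable_fun D X -> (forall w, D w -> 0 <= X w)%R ->
  \int[M]_(w in D) (exp_quotient n (X w))%:E @[n --> \oo] -->
  \int[M]_(w in D) (X w)%:E.
Proof.
move=> mD mX X0.
rewrite (_ : \int[M]_(w in D) (X w)%:E =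
    \int[M]_(w in D) limn (fun n => (exp_quotient n (X w))%:E)).
  apply: (@cvg_monotone_convergence _ _ _ M D mD
    (fun n w => (exp_quotient n (X w))%:E)).
  - move=> n; apply/measurable_EFinP; apply: (measurableT_comp _ mX).
    exact: measurable_exp_quotient.
  - by move=> n w Dw; rewrite lee_fin exp_quotient_ge0// X0.
  - by move=> w _ n m nm; rewrite lee_fin; exact: exp_quotient_nd.
apply: eq_integral => w /set_mem Dw; apply/esym/cvg_lim => //.
by apply: cvg_EFin; [exact: nearW|exact/cvg_exp_quotient/X0].
Qed.

(** Here [c] is [1 - phi] and [y] is [- ln phi] for the value [phi] of a Laplace
    transform: both have the same limit once divided by a parameter tending
    to 0. *)
Lemma le_log_quotient (y c : R) : (0 <= y -> 1 - expR (- y) = c ->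
  c <= y /\ y * (1 - c) <= c)%R.
Proof.
move=> y0 yc.
have e1 := expR_ge1Dx (- y); have e2 := expR_ge1Dx y.
have e3 : (expR y * expR (- y) = 1)%R by rewrite expRN divff// gt_eqF ?expR_gt0.
have e4 := expR_gt0 (- y).
split; first lra.
have -> : (1 - c = expR (- y))%R by lra.
have : ((1 + y) * expR (- y) <= expR y * expR (- y))%R.
  by rewrite ler_wpM2r// ltW.
lra.
Qed.

(** At [l = 0] the Laplace transform gives the probability of not being killed,
    which is 1 as the mean is finite. Then the quotient of
    [1 - E expR (- l X)] by [l] tends to the mean, while the quotient of the
    Laplace exponent by [l] tends to the drift plus the mean jump. *)
Lemma killed_subordinator_mean d (T : measurableType d) (P : probability T R)
    (X : T -> \bar R) (k dr : R)
    (ne : {measure set (measurableTypeR R) -> \bar R}) (mu : R) :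
  measurable_fun setT X -> (forall w, 0 <= X w) -> (0 <= dr)%R ->
  \int[ne]_(x in `]0%R, +oo[) (Num.min 1 x)%:E < +oo ->
  (forall l : R, (0 <= l)%R ->
    (\int[P]_(w in [set w | (X w < +oo)%E]) expR (- (l * fine (X w))) =
     expR (- (laplace_exponent k dr ne l)))%R) ->
  \int[P]_w X w = mu%:E ->
  (k = 0%R) /\ dr%:E + \int[ne]_(x in `]0%R, +oo[) x%:E = mu%:E.
Proof.
move=> mX X0 dr0 ne1 lap meanX.
set D := [set w | X w < +oo] in lap *.
have mD : measurable D.
  rewrite (_ : D = setT `&` X @^-1` [set x | x < +oo]); last by rewrite setTI.
  exact: emeasurable_fun_infty_o.
have iX : P.-integrable setT X.
  apply/integrableP; split => //.
  under eq_integral do rewrite gee0_abs//.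
  by rewrite meanX ltry.
have PD0 : P (~` D) = 0.
  apply: measure_negligible; first exact: measurableC.
  apply: negligibleS (integrable_ae measurableT iX) => w /= Dw Xw; apply: Dw.
  by move: (Xw Logic.I); rewrite fin_numElt => /andP[].
have mDC := measurableC mD.
have PD : P D = 1.
  have := probability_setC P mD; rewrite PD0 => /esym/eqP.
  have := probability_le1 P mD; have := measure_ge0 P D.
  case: (P D) => //= r r0 r1; rewrite -EFinB eqe subr_eq0 => /eqP <- //.
have k0 : k = 0%R.
  have := lap 0%R (lexx _); rewrite /laplace_exponent.
  under eq_Rintegral do rewrite mul0r oppr0 expR0.
  rewrite Rintegral_cst// mul1r.
  rewrite (_ : fine (P D) = 1%R) ?mulr0 ?addr0; last first.
    exact: (congr1 fine PD).
  under eq_Rintegral do rewrite mul0r oppr0 expR0 subrr.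
  rewrite Rintegral_cst// mul0r addr0 => /esym.
  rewrite -[X in _ = X -> _](@expR0 R) => /expR_inj /eqP.
  by rewrite oppr_eq0 => /eqP.
split=> //.
pose X' w := fine (X w).
have mX' : measurable_fun D X'.
  apply: measurable_funTS.
  by apply: measurableT_comp => //; exact: fine_measurable.
have X'0 w : D w -> (0 <= X' w)%R by move=> _; rewrite fine_ge0.
have meanXD : \int[P]_(w in D) (X' w)%:E = mu%:E.
  rewrite -meanX; rewrite [RHS](ge0_negligible_integral mDC)// setTD setCK.
  by apply: eq_integral => w /set_mem Dw; rewrite fineK// ge0_fin_numE.
have cvgX : \int[P]_(w in D) (exp_quotient n (X' w))%:E @[n --> \oo] --> mu%:E.
  by rewrite -meanXD; exact: cvg_integral_exp_quotient.
have cvgN :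
  \int[ne]_(x in `]0%R, +oo[) (exp_quotient n x)%:E @[n --> \oo] -->
  \int[ne]_(x in `]0%R, +oo[) x%:E.
  apply: (@cvg_integral_exp_quotient _ _ ne _ id) => //.
  by move=> x /=; rewrite in_itv/= andbT => /ltW.
pose a n := fine (\int[P]_(w in D) (exp_quotient n (X' w))%:E).
pose b n := fine (\int[ne]_(x in `]0%R, +oo[) (exp_quotient n x)%:E).
have q_fin n : \int[ne]_(x in `]0%R, +oo[) (exp_quotient n x)%:E \is a fin_num.
  have min0 (x : R) : `]0%R, +oo[%classic x -> 0 <= (Num.min 1 x)%:E.
    by rewrite /= in_itv/= andbT => x0; rewrite lee_fin le_min ler01/= ltW.
  have mmin : measurable_fun (`]0%R, +oo[%classic : set R)
      (fun x : R => (Num.min 1 x)%:E).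
    by apply/measurable_EFinP; apply: measurable_minr.
  have l0 := @dyadic_gt0 R n; have l1 := @dyadic_le1 R n.
  have li : 0 <= (dyadic n : R)^-1%:E by rewrite lee_fin invr_ge0 ltW//.
  rewrite ge0_fin_numE; last first.
    apply: integral_ge0 => x /=; rewrite in_itv/= andbT => x0.
    by rewrite lee_fin exp_quotient_ge0// ltW.
  apply: (@le_lt_trans _ _
    ((dyadic n)^-1%:E * \int[ne]_(x in `]0%R, +oo[) (Num.min 1 x)%:E)).
    rewrite -ge0_integralZl//.
    apply: ge0_le_integral => //.
    - move=> x /=; rewrite in_itv/= andbT => x0.
      by rewrite lee_fin exp_quotient_ge0// ltW.
    - by apply/measurable_EFinP; exact: measurable_exp_quotient.
    - exact: measurable_funeM.
    move=> x /=; rewrite in_itv/= andbT => x0.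
    rewrite -EFinM lee_fin /Num.min; case: ifPn => _.
      rewrite mulr1 /exp_quotient -[leRHS]mul1r.
      apply: ler_wpM2r; first by rewrite ltW// invr_gt0.
      by rewrite gerBl ltW// expR_gt0.
    apply: (le_trans (exp_quotient_le n x)); rewrite mulrC ler_pdivlMr//.
    by rewrite ler_piMr// ltW.
  by rewrite lte_mul_pinfty// lee_fin invr_ge0 ltW.
have expE n x : (1 - expR (- (dyadic n * x)) = dyadic n * exp_quotient n x)%R.
  by rewrite [RHS]mulrC /exp_quotient divfK// gt_eqF// dyadic_gt0.
have lapE n : laplace_exponent k dr ne (dyadic n) = (dyadic n * (dr + b n))%R.
  rewrite /laplace_exponent k0 add0r mulrDr (mulrC dr); congr (_ + _)%R.
  rewrite /Rintegral (_ : \int[ne]_(x in _) _ =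
    (dyadic n)%:E * \int[ne]_(x in `]0%R, +oo[) (exp_quotient n x)%:E).
    by rewrite fineM.
  rewrite -ge0_integralZl//.
  - by apply: eq_integral => x _; rewrite expE EFinM.
  - by apply/measurable_EFinP; exact: measurable_exp_quotient.
  - move=> x /=; rewrite in_itv/= andbT lee_fin => /ltW.
    exact: exp_quotient_ge0.
  - by rewrite lee_fin ltW// dyadic_gt0.
have aE n : (1 - expR (- (dyadic n * (dr + b n))) = dyadic n * a n)%R.
  rewrite -lapE -lap ?(ltW (dyadic_gt0 n))//.
  have mexp : measurable_fun D (fun w => (expR (- (dyadic n * fine (X w))))%:E).
    apply/measurable_EFinP; apply: measurableT_comp.
      exact: measurable_expR.
    by apply: measurableT_comp => //; apply: measurable_funM.
  have mq : measurable_fun D (fun w => (exp_quotient n (X' w))%:E).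
    apply/measurable_EFinP; apply: (measurableT_comp _ mX').
    exact: measurable_exp_quotient.
  have q0 w : D w -> 0 <= (exp_quotient n (X' w))%:E.
    by move=> Dw; rewrite lee_fin exp_quotient_ge0 ?X'0.
  have lq : (dyadic n)%:E * \int[P]_(w in D) (exp_quotient n (X' w))%:E +
      \int[P]_(w in D) (expR (- (dyadic n * fine (X w))))%:E = 1.
    have l0 : 0 <= (dyadic n : R)%:E by rewrite lee_fin ltW// dyadic_gt0.
    have lq0 w : D w -> 0 <= (dyadic n : R)%:E * (exp_quotient n (X' w))%:E.
      by move=> Dw; rewrite mule_ge0 ?q0.
    have mlq : measurable_fun D
        (fun w => (dyadic n : R)%:E * (exp_quotient n (X' w))%:E).
      exact: measurable_funeM.
    rewrite -ge0_integralZl// -ge0_integralD//.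
    rewrite (_ : 1 = 1%:E * P D); last by rewrite PD mule1.
    rewrite -integral_cst//; apply: eq_integral => w _.
    by rewrite -EFinM -expE -EFinD/= subrK.
  have e_fin :
      \int[P]_(w in D) (expR (- (dyadic n * fine (X w))))%:E \is a fin_num.
    rewrite ge0_fin_numE; last first.
      by apply: integral_ge0 => *; rewrite lee_fin expR_ge0.
    apply: (@le_lt_trans _ _ 1); last by rewrite ltry.
    rewrite -lq leeDr// mule_ge0 ?lee_fin ?(ltW (dyadic_gt0 n))//.
    exact: integral_ge0.
  have a_fin :
      \int[P]_(w in D) (exp_quotient n (X' w))%:E \is a fin_num.
    rewrite ge0_fin_numE; last exact: integral_ge0.
    apply: (@le_lt_trans _ _ mu%:E); last by rewrite ltry.
    rewrite -meanXD; apply: ge0_le_integral => //.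
      exact/measurable_EFinP.
    by move=> w Dw; rewrite lee_fin exp_quotient_le.
  rewrite /Rintegral /a; apply/eqP; rewrite subr_eq.
  rewrite -[X in (X * _)%R]/(fine (dyadic n)%:E).
  by rewrite -fineM// -fineD ?fin_numM// lq.
have b0 n : (0 <= b n)%R.
  apply/fine_ge0/integral_ge0 => x /=; rewrite in_itv/= andbT => x0.
  by rewrite lee_fin exp_quotient_ge0// ltW.
have acvg : a n @[n --> \oo] --> mu by exact: fine_cvg cvgX.
have ab n : (a n <= dr + b n /\ (dr + b n) * (1 - dyadic n * a n) <= a n)%R.
  have l0 := @dyadic_gt0 R n.
  have y0 : (0 <= dyadic n * (dr + b n))%R.
    by rewrite mulr_ge0 ?addr_ge0 ?(ltW l0).
  have [] := le_log_quotient _ _ y0 (aE n).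
  by rewrite ler_pM2l// -mulrA ler_pM2l.
have bcvg : (dr + b n)%R @[n --> \oo] --> mu.
  have lacvg : (1 - dyadic n * a n)%R @[n --> \oo] --> (1 : R)%R.
    rewrite -[X in _ --> X]subr0; apply: cvgB; first exact: cvg_cst.
    rewrite -[X in _ --> X](mul0r mu); apply: cvgM => //; exact: cvg_dyadic.
  apply: (@squeeze_cvgr _ _ _ _ a
    (fun n => a n / (1 - dyadic n * a n))%R) => //.
    apply: nearW => n; have [-> /=] := ab n.
    by rewrite ler_pdivlMr// -aE opprB addrC subrK expR_gt0.
  rewrite -[X in _ --> X]mulr1 -[X in (_ * X)%R](@invr1 R).
  by apply: cvgM => //; exact: cvgV (oner_neq0 _) lacvg.
have h1 : dr%:E + (b n)%:E @[n --> \oo] -->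
    dr%:E + \int[ne]_(x in `]0%R, +oo[) x%:E.
  apply: cvgeD.
  - by [].
  - exact: cvg_cst.
  - rewrite (_ : (fun n => (b n)%:E) =
      (fun n => \int[ne]_(x in `]0%R, +oo[) (exp_quotient n x)%:E))//.
    by apply/funext => n; rewrite /b fineK.
have h2 : dr%:E + (b n)%:E @[n --> \oo] --> mu%:E.
  by apply: cvg_EFin; [exact: nearW|].
exact: (cvg_unique _ h1 h2).
Qed.

End mean.

(** * The mass of the potential measure *)

Section potential_mass.
Context {R : realType} {d : measure_display} {T : measurableType d}.
Variables (P : probability T R) (H : R -> T -> \bar R).
Local Open Scope ereal_scope.

(** By right-continuity a path that is finite at time [t] still is at some
    later rational time, so the set is a countable union of rectangles. *)
Lemma measurable_lifetime : killed_subordinator P H ->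
  measurable ([set z | (0 <= z.2)%R /\ H z.2 z.1 < +oo]
    : set (T * measurableTypeR R)%type).
Proof.
move=> [mH _ Hnd Hrc _].
rewrite (_ : [set z | _] = \bigcup_(q : rat)
  (if (0 <= ratr q :> R)%R then
    [set w | H (ratr q) w < +oo] `*` `[0%R, (ratr q : R)[%classic else set0)).
  apply: bigcupT_measurable_rat => q; case: ifPn => // q0.
  apply: measurableX; last exact: measurable_itv.
  rewrite (_ : [set w | _] = setT `&` H (ratr q) @^-1` [set x | x < +oo]).
    exact: (emeasurable_fun_infty_o measurableT (mH _ q0)).
  by rewrite setTI.
apply/seteqP; split => [[w t] /= [t0 Ht]|[w t] /= [q _]].
  have Ht' : H s w @[s --> t^'+] --> (fine (H t w))%:E.
    rewrite fineK; first exact: Hrc.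
    by rewrite ge0_fin_numE//; have /andP[] := Hnd w _ _ t0 (lexx t).
  have := fcvg_is_fine Ht'; rewrite near_map near_withinE.
  move=> /nbhs_ballP[e /= e0 He].
  have [q] := @rat_in_itvoo _ t (t + e)%R ltac:(by rewrite ltrDl).
  rewrite in_itv/= => /andP[tq qe].
  have q0 : (0 <= ratr q :> R)%R by rewrite ltW// (le_lt_trans t0).
  exists q => //; rewrite q0; split => /=; last by rewrite in_itv/= t0.
  have : H (ratr q) w \is a fin_num.
    apply: He => //; rewrite /ball/= ltr_distlC; apply/andP; split; lra.
  by rewrite fin_numElt => /andP[].
case: ifPn => // q0 [/= Hq]; rewrite in_itv/= => /andP[t0 tq].
split=> //; apply: le_lt_trans Hq.
by have /andP[] := Hnd w _ _ t0 (ltW tq).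
Qed.

Lemma prob_alive (k dr : R) (nu : {measure set (measurableTypeR R) -> \bar R})
    (t : R) : killed_subordinator P H -> characteristics P H k dr nu ->
  (0 <= t)%R -> P [set w | H t w < +oo] = (expR (- (k * t)))%:E.
Proof.
move=> [mH _ _ _ _] [_ _ _ char] t0.
have mD : measurable [set w | H t w < +oo].
  rewrite (_ : [set w | _] = setT `&` H t @^-1` [set x | x < +oo]).
    exact: (emeasurable_fun_infty_o measurableT (mH _ t0)).
  by rewrite setTI.
have := char t 0%R t0 (lexx _); rewrite /laplace_exponent.
under eq_Rintegral do rewrite mul0r oppr0 expR0.
rewrite Rintegral_cst// mul1r mulr0 addr0.
under eq_Rintegral do rewrite mul0r oppr0 expR0 subrr.
rewrite Rintegral_cst// mul0r addr0 mulrC => <-.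
by rewrite fineK// fin_num_measure.
Qed.

(** The mass is the expected lifetime, and by [prob_alive] the lifetime is
    exponential of parameter [k]. *)
Lemma potential_mass (k dr : R)
    (nu : {measure set (measurableTypeR R) -> \bar R}) :
  killed_subordinator P H -> characteristics P H k dr nu -> (0 < k)%R ->
  potential P H (EFin @` `[0%R, +oo[%classic) = (k^-1)%:E.
Proof.
move=> Hs Hc k0; have mE := measurable_lifetime Hs.
have [mH _ Hnd _ _] := Hs.
set E := [set z | _] in mE.
transitivity (\int[P]_w (@lebesgue_measure R) [set t | E (w, t)]).
  rewrite /potential; apply: eq_integral => w _.
  rewrite -integral_indic_set; last first.
    by have := measurable_xsection w mE; rewrite xsectionE.
  rewrite [LHS]integral_mkcond. apply: eq_integral => t _; rewrite patchE.
  have [|] := boolP (t \in _).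
    rewrite inE/= in_itv/= andbT => t0.
    have /andP[Ht0 _] := Hnd w _ _ t0 (lexx t).
    rewrite !indicE; congr (_%:R%:E); congr nat_of_bool.
    apply/idP/idP => /set_mem tE; apply/mem_set.
      by case: tE => r _ rE; split => //=; rewrite -rE ltry.
    exists (fine (H t w)); last by rewrite fineK// ge0_fin_numE//; case: tE.
    by rewrite /= in_itv/= andbT fine_ge0.
  rewrite notin_setE/= in_itv/= andbT => t0; rewrite indicE memNset//.
  by case.
have sL : sigma_finite setT (@lebesgue_measure R).
  exact: sigma_finiteT.
rewrite tonelli_sets//; last exact: sigma_finiteT.
transitivity (\int[lebesgue_measure]_t ((k^-1)%:E * (exponential_pdf k t)%:E)).
  apply: eq_integral => t _; have [t0|t0] := leP 0%R t.
    rewrite exponential_pdfE// -EFinM mulKf ?gt_eqF// mulNr.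
    rewrite -(prob_alive k dr nu t Hs Hc t0); congr (P _).
    by apply/seteqP; split => w /=; rewrite /E/=; [case|].
  rewrite lt0_exponential_pdf// mule0.
  rewrite (_ : [set w | _] = set0) ?measure0//.
  by apply/seteqP; split => w //= [/= ]; rewrite leNgt t0.
rewrite ge0_integralZl//; first by rewrite integral_exponential_pdf// mule1.
- by apply/measurable_EFinP; exact: measurable_exponential_pdf.
- by move=> t _; rewrite lee_fin exponential_pdf_ge0// ltW.
- by rewrite lee_fin invr_ge0 ltW.
Qed.

End potential_mass.

(** * Long tailed measures *)

Section long_tailed_measures.
Context {R : realType}.
Implicit Types (M : {measure set (measurableTypeR R) -> \bar R}).

Lemma long_tailedP M : (M `]-oo, 0%R[%classic = 0)%E ->
  (forall x : R, 0 < x -> (tail M x < +oo)%E) ->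
  long_tailed M <-> positive_on_pos (fine \o tail M) /\
                    slowly_decaying (fine \o tail M).
Proof.
move=> M0 Mfin; split=> [[_ Mt Mr]|[M1 Mr]].
  split => // x x0; rewrite /= fine_gt0//; exact: Mt.
split => // x x0; rewrite Mfin// andbT.
by have := M1 _ x0; rewrite /=; case: (tail M x) => [r||]//=; rewrite ltxx.
Qed.

Lemma long_tailed_on_posP M : (M `]-oo, 0%R]%classic = 0)%E ->
  (forall x : R, 0 < x -> (tail M x < +oo)%E) ->
  long_tailed M <-> positive_on_pos (fine \o tail M) /\
                    slowly_decaying (fine \o tail M).
Proof.
move=> M0; apply: long_tailedP; apply/eqP.
rewrite eq_le measure_ge0 andbT -M0.
apply: le_measure; rewrite ?inE; try exact: measurable_itv.
by move=> y /=; rewrite !in_itv/= => /ltW.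
Qed.

Lemma slowly_decaying_congr (f g : R -> R) :
  (forall x : R, 0 < x -> f x = g x) -> slowly_decaying f -> slowly_decaying g.
Proof.
move=> fg fs t; apply: near_eq_cvg_to (fs t); near=> x.
have x0 : 0 < x by near: x; exact: near_pinfty_gt.
have xt0 : 0 < x + t.
  by rewrite -ltrBlDr sub0r; near: x; exact: near_pinfty_gt.
by rewrite !fg.
Unshelve. all: by end_near. Qed.

Lemma tail_positive_part M (x : R) : 0 <= x ->
  tail (positive_part M) x = tail M x.
Proof.
move=> x0; rewrite /tail /positive_part /= /mrestr; congr (M _); apply: setIidl.
by move=> y /=; rewrite !in_itv/= !andbT; exact: le_lt_trans.
Qed.

Lemma long_tailed_positive_partP M :
  (forall x : R, 0 < x -> (tail M x < +oo)%E) ->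
  long_tailed (positive_part M) <-> positive_on_pos (fine \o tail M) /\
                    slowly_decaying (fine \o tail M).
Proof.
move=> Mfin.
have E (x : R) : 0 < x ->
    (fine \o tail (positive_part M)) x = (fine \o tail M) x.
  move=> x0; rewrite /comp; congr fine.
  exact: tail_positive_part M x (ltW x0).
have fin (x : R) : 0 < x -> (tail (positive_part M) x < +oo)%E.
  move=> x0; have := Mfin x x0.
  by rewrite -(tail_positive_part M x (ltW x0)).
have neg : (positive_part M `]-oo, 0%R[%classic = 0)%E.
  rewrite /positive_part /= /mrestr (_ : _ `&` _ = set0) ?measure0//.
  apply/seteqP; split => // y [] /=; rewrite !in_itv/= andbT => y0 y1.
  by have := lt_trans y0 y1; rewrite ltxx.
apply: iff_trans (long_tailedP _ neg fin) _.
split => -[h1 h2]; split.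
- by move=> x x0; rewrite -E// h1.
- exact: slowly_decaying_congr h2.
- by move=> x x0; rewrite E// h1.
- by apply: slowly_decaying_congr h2 => x x0; rewrite E.
Qed.

Lemma fine_tail_nonincreasing M : (forall x : R, 0 < x -> (tail M x < +oo)%E) ->
  nonincreasing_on_pos (fine \o tail M).
Proof.
move=> Mfin x y x0 xy; have y0 := lt_le_trans x0 xy.
by rewrite /= fine_le ?ge0_fin_numE ?tail_ge0 ?Mfin// tail_nonincreasing.
Qed.

Lemma tail_fineE M (x : R) : (tail M x < +oo)%E ->
  tail M x = (fine (tail M x))%:E.
Proof. by move=> h; rewrite fineK// ge0_fin_numE// tail_ge0. Qed.

Lemma mass_ocE M (x y : R) : (tail M x < +oo)%E -> x <= y ->
  M `]x, y]%classic = (fine (tail M x) - fine (tail M y))%:E.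
Proof.
move=> Mx xy; have My : (tail M y < +oo)%E.
  by apply: le_lt_trans Mx; exact: tail_nonincreasing.
rewrite EFinB -!tail_fineE// (tail_split M x y xy) addeK//.
by rewrite ge0_fin_numE// tail_ge0.
Qed.

End long_tailed_measures.

(** * A lower bound from the first identity *)

Section renewal.
Context {R : realType}.
Variables (Pi po V : {measure set (measurableTypeR R) -> \bar R}) (k : R).
Hypothesis k0 : 0 < k.
Hypothesis po_fin : forall x : R, 0 < x -> (tail po x < +oo)%E.
Hypothesis Pi_fin : forall x : R, 0 < x -> (tail Pi x < +oo)%E.
Hypothesis V_mass : V `[0%R, +oo[%classic = k^-1%:E.
Hypothesis vigon_po : forall x : R, 0 < x ->
  tail po x = (\int[V]_(y in `[0%R, +oo[) tail Pi (x + y)%R)%E.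

(** Restrict the integral to [0, u], where the tail of [Pi] is at least its
    value at [x + u], with [u] so large that this interval carries almost all
    the mass [1 / k] of the potential measure. *)
Lemma renewal_lower_bound (e : R) : 0 < e -> exists u v : R,
  [/\ 0 <= u, 1 - e <= v * k &
     forall x : R, 0 < x -> v * fine (tail Pi (x + u)) <= fine (tail po x)].
Proof.
move=> e0.
have Vcvg : V `[0%R, n%:R]%classic @[n --> \oo] --> k^-1%:E.
  rewrite -V_mass.
  rewrite (_ : `[0%R, +oo[%classic = \bigcup_n `[0%R, (n%:R : R)]%classic).
    apply: nondecreasing_cvg_mu => //.
      by apply: bigcupT_measurable => n; exact: measurable_itv.
    move=> n m nm; apply/subsetPset => y /=; rewrite !in_itv/= => /andP[-> yn].
    by rewrite (le_trans yn)// ler_nat.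
  apply/seteqP; split => [y /=|y [n _] /=]; rewrite !in_itv/=.
    rewrite andbT => y0; exists (Num.trunc y).+1 => //=.
    by rewrite in_itv/= y0 ltW// truncnS_gt.
  by move=> /andP[->].
have ek : 0 < e / k by rewrite divr_gt0.
have /fine_cvgP[Vfin /cvgrPdist_le/(_ _ ek)] := Vcvg.
move=> [n _ /(_ n (leqnn n)) /= Vn].
exists n%:R, (fine (V `[0%R, n%:R]%classic)).
split => //.
  move: Vn => /(le_trans (ler_norm _)); rewrite lerBlDr -lerBlDl.
  by rewrite -(ler_pM2r k0) mulrBl mulVf ?gt_eqF// divfK ?gt_eqF.
move=> x x0; have xn : 0 < x + n%:R by rewrite ltr_wpDr.
have Vn_fin : V `[0%R, n%:R]%classic \is a fin_num.
  rewrite ge0_fin_numE ?measure_ge0//.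
  apply: (@le_lt_trans _ _ (V `[0%R, +oo[%classic)).
    apply: le_measure; rewrite ?inE; try exact: measurable_itv.
    by move=> y /=; rewrite !in_itv/= => /andP[->].
  by rewrite V_mass ltry.
rewrite -lee_fin EFinM fineK// -!tail_fineE ?po_fin ?Pi_fin// vigon_po//.
have mt (D : set R) : measurable D ->
    measurable_fun D (fun y : R => tail Pi (x + y)).
  move=> mD; apply: measurable_funTS.
  apply: (measurableT_comp (measurable_tail Pi)).
  exact: measurable_funD.
apply: (@le_trans _ _ (\int[V]_(y in `[0%R, n%:R]) tail Pi (x + y)%R)%E).
  rewrite muleC -integral_cst//=; apply: ge0_le_integral => //=.
  - exact: mt.
  - move=> y /=; rewrite in_itv/= => /andP[_ yn].
    by apply: tail_nonincreasing; lra.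
apply: ge0_subset_integral => //=.
- exact: mt.
- by move=> y /=; rewrite !in_itv/= => /andP[->].
Qed.

End renewal.

(** * Consequences of the second identity *)

Section ladder_pair.
Context {R : realType}.
Variables (Pi po ne : {measure set (measurableTypeR R) -> \bar R}).
Variables (drhat khat : R) (p : R -> R).
Hypothesis po0 : (po `]-oo, 0%R]%classic = 0)%E.
Hypothesis po_fin : forall x : R, 0 < x -> (tail po x < +oo)%E.
Hypothesis ne0 : (ne `]-oo, 0%R]%classic = 0)%E.
Hypothesis ne_fin : forall x : R, 0 < x -> (tail ne x < +oo)%E.
Hypothesis Pi_fin : forall x : R, 0 < x -> (tail Pi x < +oo)%E.
Hypothesis drhat0 : 0 <= drhat.
Hypothesis khat0 : 0 <= khat.
Hypothesis p_density : 0 < drhat -> density_on_pos po p.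
Hypothesis vigon_Pi : forall x : R, 0 < x ->
  tail Pi x = (overshoot po ne x + (drhat * p x)%:E + khat%:E * tail po x)%E.

Let spo := sigma_finite_of_tails po po0 po_fin.
Let sne := sigma_finite_of_tails ne ne0 ne_fin.

Lemma creeping_ge0 x : 0 < x -> 0 <= drhat * p x.
Proof.
move=> x0; have [/p_density[_ p0 _]|d0] := ltP 0 drhat.
  by rewrite mulr_ge0// p0.
by rewrite (_ : drhat = 0) ?mul0r//; apply/eqP; rewrite eq_le d0.
Qed.

Lemma measurable_creeping (D : set R) : measurable D -> D `<=` `]0, +oo[ ->
  measurable_fun D (fun x => (drhat * p x)%:E).
Proof.
move=> mD D0; apply/measurable_EFinP.
have [/p_density[mp _ _]|d0] := ltP 0 drhat.
  apply: measurable_funM; first exact: measurable_cst.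
  exact: measurable_funS mp.
rewrite (_ : drhat = 0); last by apply/eqP; rewrite eq_le d0.
by under eq_fun do rewrite mul0r; exact: measurable_cst.
Qed.

Lemma integral_creeping (D : set R) : measurable D -> D `<=` `]0, +oo[ ->
  (\int[lebesgue_measure]_(x in D) (drhat * p x)%:E = drhat%:E * po D)%E.
Proof.
move=> mD D0; have [d0|d0] := ltP 0 drhat.
  have [mp p0 pB] := p_density d0.
  have mpD : measurable_fun D (fun x => (p x)%:E).
    by apply/measurable_EFinP; exact: measurable_funS mp.
  have pD0 x : D x -> (0 <= (p x)%:E)%E.
    by move=> /D0; rewrite /= in_itv/= andbT lee_fin => /p0.
  by rewrite pB// -ge0_integralZl// lee_fin.
rewrite (_ : drhat = 0); last by apply/eqP; rewrite eq_le d0.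
by rewrite mul0e integral0_eq// => x _; rewrite mul0r.
Qed.

Lemma overshoot_fin x : 0 < x -> (overshoot po ne x < +oo)%E.
Proof.
move=> x0; apply: le_lt_trans (Pi_fin x x0); rewrite vigon_Pi// -addeA leeDl//.
rewrite adde_ge0// ?lee_fin ?creeping_ge0// mule_ge0// lee_fin.
Qed.

Lemma overshoot_ge0 x : (0 <= overshoot po ne x)%E.
Proof. by apply: integral_ge0 => y _; exact: tail_ge0. Qed.

Lemma overshoot_fineE x : 0 < x ->
  overshoot po ne x = (fine (overshoot po ne x))%:E.
Proof.
by move=> x0; rewrite fineK// ge0_fin_numE ?overshoot_ge0// overshoot_fin.
Qed.

Lemma vigon_Pi_fine x : 0 < x -> fine (tail Pi x) =
  fine (overshoot po ne x) + drhat * p x + khat * fine (tail po x).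
Proof.
move=> x0; apply: EFin_inj; rewrite !EFinD (EFinM khat) -overshoot_fineE//.
rewrite -(tail_fineE Pi x (Pi_fin x x0)) -(tail_fineE po x (po_fin x x0)).
exact: vigon_Pi.
Qed.

Section no_killing.
Variable mu : R.
Hypothesis khatE : khat = 0.
Hypothesis meanE : (drhat%:E + \int[ne]_(x in `]0%R, +oo[) x%:E = mu%:E)%E.
Hypothesis Pi_pos : (0 < Pi `]0%R, +oo[%classic)%E.

Let B_fin : (\int[ne]_(x in `]0%R, +oo[) x%:E)%E \is a fin_num.
Proof.
by have : mu%:E \is a fin_num by []; rewrite -meanE fin_numD => /andP[].
Qed.

Let cap_fin u : capped_mean ne u \is a fin_num.
Proof.
rewrite ge0_fin_numE ?capped_mean_ge0//.
by apply: le_lt_trans (capped_mean_le ne u) _; rewrite ltey_eq B_fin.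
Qed.

(** The mean of the dual ladder height with its jumps truncated at [u]. *)
Definition weight (u : R) : R := drhat + fine (capped_mean ne u).

Lemma weightE u : (weight u)%:E = (drhat%:E + capped_mean ne u)%E.
Proof. by rewrite /weight EFinD fineK. Qed.

Lemma weight_nd : {homo weight : u v / u <= v}.
Proof. by move=> u v uv; rewrite lerD2l fine_le//; exact: capped_mean_nd. Qed.

Lemma weight_ge0 u : 0 <= weight u.
Proof. by rewrite addr_ge0// fine_ge0// capped_mean_ge0. Qed.

Lemma weight_le u : weight u <= mu.
Proof. by rewrite -lee_fin weightE -meanE leeD2l// capped_mean_le. Qed.

(** If the weight vanished at one positive point, then the drift and all of
    [ne] on the positive half-line would vanish, and the identity would leave no
    positive jumps to [Pi]. *)
Lemma weight_gt0 s : 0 < s -> 0 < weight s.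
Proof.
move=> s0; rewrite lt_neqAle eq_sym weight_ge0 andbT; apply/eqP => ws0.
have cap0 := fine_ge0 (capped_mean_ge0 ne s).
have d0 : drhat = 0.
  apply/eqP; rewrite eq_le drhat0 andbT -ws0 /weight; lra.
have [v v0] := ex_tail_gt0 Pi Pi_pos; rewrite vigon_Pi// khatE mul0e adde0.
rewrite d0 mul0r adde0 /overshoot integral0_eq ?ltxx// => y /=.
rewrite in_itv/= andbT => vy; apply/eqP; rewrite eq_le tail_ge0 andbT leNgt.
apply/negP => ty.
have yv : 0 < y - v by rewrite subr_gt0.
have := capped_mean_ge ne s (y - v) s0 yv.
have := weightE s; rewrite ws0 d0 add0e => <-.
by rewrite leNgt mule_gt0// lte_fin lt_min s0.
Qed.

Lemma mean_gt0 : 0 < mu.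
Proof. exact: lt_le_trans (weight_gt0 _ ltr01) (weight_le 1). Qed.

Lemma weight_approx (e : R) : 0 < e -> exists2 u, 0 < u & mu - e <= weight u.
Proof.
move=> e0; have := cvg_capped_mean ne; rewrite -(fineK B_fin) => /fine_cvg.
move=> /cvgrPdist_le/(_ _ e0) H.
have : \forall n \near \oo, mu - e <= weight n%:R /\ (0 < n)%N.
  near=> n; split; last by near: n; exact: nbhs_infty_gt.
  have : `|fine (\int[ne]_(x in `]0%R, +oo[) x%:E) -
      fine (capped_mean ne n%:R)| <= e.
    by near: n.
  move=> /(le_trans (ler_norm _)).
  have -> : mu = drhat + fine (\int[ne]_(x in `]0%R, +oo[) x%:E)%E.
    by apply: EFin_inj; rewrite EFinD fineK.
  rewrite /weight; lra.
move=> [n _ /(_ n (leqnn n))[h n0]]; exists n%:R => //.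
by rewrite ltr0n.
Unshelve. all: by end_near. Qed.

Lemma weight_lt_mean : (0 < ne `]0%R, +oo[%classic)%E ->
  exists2 u, 0 < u & weight u < mu.
Proof.
move=> /ex_tail_gt0[v v0 tv]; exists (v / 2); first by rewrite divr_gt0.
have h : (capped_mean ne (v / 2) + (v - v / 2)%:E * tail ne v <=
    \int[ne]_(s in `]0%R, +oo[) s%:E)%E by apply: capped_mean_gap; lra.
rewrite -lte_fin weightE -meanE lteD2lE//; apply: lt_le_trans h.
by rewrite lteDl// mule_gt0// lte_fin; lra.
Qed.

(** Vigon's second identity, integrated over [x, +oo[. *)
Lemma integrated_tailE x : 0 < x ->
  tail (integrated_tail Pi) x = smeared po weight x.
Proof.
move=> x0; rewrite tail_integrated_tail ?(ltW x0)//.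
have pos (y : R) : y \in `]x, +oo[ -> 0 < y.
  by rewrite in_itv/= andbT; exact: lt_trans.
have sub : `]x, +oo[%classic `<=` (`]0, +oo[%classic : set R).
  by move=> y /pos y0 /=; rewrite in_itv/= andbT.
transitivity (\int[lebesgue_measure]_(z in `]x, +oo[)
    (overshoot po ne z + (drhat * p z)%:E))%E.
  apply: eq_integral => z /set_mem /pos z0.
  by rewrite vigon_Pi// khatE mul0e adde0.
rewrite ge0_integralD//; first last.
- by apply: measurable_creeping => //; exact: measurable_itv.
- by move=> y /pos y0; rewrite lee_fin creeping_ge0.
- by apply: measurable_funTS; exact: measurable_overshoot.
- by move=> y _; exact: overshoot_ge0.
rewrite integral_overshoot// integral_creeping//.
rewrite /smeared; under [RHS]eq_integral do rewrite weightE.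
rewrite ge0_integralD//; first by rewrite integral_cst// addeC.
- by move=> y _; exact: capped_mean_ge0.
rewrite (_ : (fun y => _) = (fun y => (weight (y - x) - drhat)%:E)).
  apply/measurable_EFinP; apply: nondecreasing_measurable => // y z yz.
  by rewrite lerD2r weight_nd//; lra.
by apply/funext => y; rewrite EFinB weightE addeAC subee// add0e.
Qed.

Let G := fine \o tail po.
Let I := fine \o tail (integrated_tail Pi).

Lemma integrated_tail_fin x : 0 < x -> (tail (integrated_tail Pi) x < +oo)%E.
Proof.
move=> x0; rewrite integrated_tailE//.
apply: le_lt_trans (smeared_le po weight mu weight_nd weight_ge0 weight_le x) _.
by rewrite tail_fineE ?po_fin// -EFinM ltry.
Qed.

Lemma smeared_fineE x : 0 < x -> smeared po weight x = (I x)%:E.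
Proof.
move=> x0.
by rewrite /I /= -tail_fineE ?integrated_tail_fin// integrated_tailE.
Qed.

Lemma integrated_tail_le x : 0 < x -> I x <= mu * G x.
Proof.
move=> x0; rewrite -lee_fin -smeared_fineE// EFinM -tail_fineE ?po_fin//.
exact: smeared_le weight_nd weight_ge0 weight_le x.
Qed.

Lemma integrated_tail_ge x u : 0 < x -> 0 < u -> weight u * G (x + u) <= I x.
Proof.
move=> x0 u0; rewrite -lee_fin -smeared_fineE// EFinM -tail_fineE; last first.
  by rewrite po_fin// addr_gt0.
by apply: (smeared_ge _ _ weight_nd weight_ge0); exact: ltW.
Qed.

Lemma integrated_tail_increment x s t : 0 < x -> 0 < s -> s <= t ->
  I (x + t) + weight s * (G (x + s) - G (x + t)) <= I x.
Proof.
move=> x0 s0 st; rewrite -lee_fin EFinD EFinM -!smeared_fineE//; last lra.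
rewrite -mass_ocE; [|by apply: po_fin; lra|lra].
by apply: (smeared_increment _ _ weight_nd weight_ge0) => //; exact: ltW.
Qed.

Lemma integrated_tail_split x u : 0 < x -> 0 < u ->
  I x <= mu * G (x + u) + weight u * (G x - G (x + u)).
Proof.
move=> x0 u0; rewrite -lee_fin EFinD !EFinM -smeared_fineE//.
rewrite -mass_ocE; [|exact: po_fin|lra].
rewrite -tail_fineE; last by apply: po_fin; lra.
by apply: (smeared_le_split _ _ _ weight_nd weight_ge0 weight_le); exact: ltW.
Qed.

Lemma finite_mean_equivalence :
  let a1 := long_tailed (integrated_tail Pi) in
  let a2 := long_tailed po in
  let a3 := asymp_equiv (fun x => fine (tail po x))
              (fun x => mu^-1 * fine (tail (integrated_tail Pi) x)) in
  ((0 < ne `]0%R, +oo[%classic)%E -> [<-> a1; a2; a3]) /\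
  (a1 <-> a2) /\ (a2 -> a3).
Proof.
move=> a1 a2 a3.
have a1P : a1 <-> positive_on_pos I /\ slowly_decaying I.
  apply: long_tailedP; last exact: integrated_tail_fin.
  rewrite /= /Defs.integrated_tail (_ : _ `&` _ = set0) ?integral_set0//.
  apply/seteqP; split => // y [] /=; rewrite !in_itv/= andbT => y0 y1.
  by have := lt_le_trans y0 y1; rewrite ltxx.
have a2P : a2 <-> positive_on_pos G /\ slowly_decaying G.
  exact: long_tailed_on_posP.
have G_ge0 (x : R) : 0 < x -> 0 <= G x by move=> _; rewrite fine_ge0// tail_ge0.
have Gd : nonincreasing_on_pos G by exact: fine_tail_nonincreasing.
have mu0 := mean_gt0.
have a12 : a1 -> a2.
  move=> /a1P[I0 Is]; apply/a2P; split.
    exact: positive_of_smeared mu0 integrated_tail_le I0.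
  exact: slowly_of_smeared mu0 weight_gt0 Gd integrated_tail_le
    integrated_tail_increment I0 Is.
have a21 : a2 -> a1.
  move=> /a2P[G0 Gs]; apply/a1P.
  exact: smeared_of_slowly mu0 weight_gt0 weight_approx G_ge0 Gd
    integrated_tail_le integrated_tail_ge G0 Gs.
have a23 : a2 -> a3.
  move=> /a2P[G0 Gs].
  exact: equiv_of_slowly mu0 weight_approx G_ge0 Gd integrated_tail_le
    integrated_tail_ge G0 Gs.
split=> [ne_pos|]; last by split.
tfae => // GI; apply/a21/a2P.
exact: slowly_of_equiv mu0 G_ge0 Gd integrated_tail_split
  (weight_lt_mean ne_pos) GI.
Qed.

End no_killing.

Let G := fine \o tail po.
Let A := fine \o overshoot po ne.
Let r := fun x => drhat * p x.

Let G_ge0 x : 0 <= G x. Proof. by rewrite fine_ge0// tail_ge0. Qed.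

Let A_ge0 x : 0 <= A x. Proof. by rewrite fine_ge0// overshoot_ge0. Qed.

Let Gd : nonincreasing_on_pos G.
Proof. exact: fine_tail_nonincreasing. Qed.

Lemma overshoot_ge (x u : R) : 0 < x -> 0 < u ->
  fine (tail ne u) * (G x - G (x + u)) <= A x.
Proof.
move=> x0 u0; rewrite -lee_fin -[leRHS]overshoot_fineE// EFinM.
rewrite -mass_ocE; last 2 first.
- exact: po_fin.
- lra.
rewrite -tail_fineE ?ne_fin//.
have mt (D : set R) : measurable D ->
    measurable_fun D (fun y : R => tail ne (y - x)).
  move=> mD; apply: measurable_funTS.
  apply: (measurableT_comp (measurable_tail ne)).
  exact: measurable_funB.
apply: (@le_trans _ _ (\int[po]_(y in `]x, (x + u)%R]) tail ne (y - x)%R)%E).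
  rewrite -integral_cst//=; apply: ge0_le_integral => //=.
  - exact: mt.
  - move=> y /=; rewrite in_itv/= => /andP[_ yu].
    by apply: tail_nonincreasing; lra.
apply: ge0_subset_integral => //=.
- exact: mt.
- by move=> y /=; rewrite !in_itv/= andbT => /andP[].
Qed.

Lemma creeping_gap (x C : R) : 0 < x -> 0 <= C ->
  (forall y, x < y -> r y <= C) -> drhat * (G x - G (x + 1)) <= C.
Proof.
move=> x0 C0 rC; rewrite -lee_fin EFinM -mass_ocE; [|exact: po_fin|lra].
have sub : `]x, (x + 1)%R]%classic `<=` (`]0, +oo[%classic : set R).
  by move=> y /=; rewrite !in_itv/= andbT => /andP[/(lt_trans x0)].
rewrite -integral_creeping//.
apply: (@le_trans _ _ (C%:E * (@lebesgue_measure R) `]x, (x + 1)%R]%classic)%E).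
  apply: integral_le_cst => //.
  - by apply: measurable_creeping => //; exact: measurable_itv.
  - by move=> y /sub /=; rewrite in_itv/= andbT; exact: creeping_ge0.
  - by move=> y /=; rewrite in_itv/= => /andP[/rC].
rewrite lebesgue_measure_itv/= lte_fin ltrDl ltr01 -EFinD -EFinM lee_fin.
by rewrite addrAC subrr add0r mulr1.
Qed.

(** Either part of the remainder dominates a decrease of [G]: the overshoot
    one over any [u] beyond which [ne] still has mass, and the drift part,
    after integration, one over a unit interval. *)
Lemma slowly_of_negligible_remainder : positive_on_pos G ->
  negligible_wrt (A \+ r) G ->
  (0 < ne `]0%R, +oo[%classic)%E \/ 0 < drhat -> slowly_decaying G.
Proof.
move=> G0 Ar [/ex_tail_gt0[u u0 tu]|d0].
  apply: (slowly_decaying_step _ u) => // e e0.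
  have c0 : 0 < fine (tail ne u) by rewrite fine_gt0// tu ne_fin.
  have := Ar _ (mulr_gt0 c0 e0) => H; near=> x.
  have x0 : 0 < x by near: x; exact: near_pinfty_gt.
  have Hx : A x + r x <= fine (tail ne u) * e * G x by near: x.
  rewrite -(ler_pM2l c0) mulrA; apply: le_trans (overshoot_ge x u x0 u0) _.
  by apply: le_trans Hx; rewrite lerDl; exact: creeping_ge0.
apply: (slowly_decaying_step _ 1) => // e e0.
have [M [_ HM]] := Ar _ (mulr_gt0 d0 e0); near=> x.
have x0 : 0 < x by near: x; exact: near_pinfty_gt.
have xM : M < x by near: x; exact: near_pinfty_gt.
have de0 : 0 <= drhat * e by rewrite ltW// mulr_gt0.
rewrite -(ler_pM2l d0) mulrA; apply: creeping_gap => //.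
  by rewrite mulr_ge0.
move=> y xy; have := HM y (lt_trans xM xy); rewrite /= => h.
apply: (@le_trans _ _ (A y + r y)); first by rewrite lerDr.
by apply: (le_trans h); rewrite ler_wpM2l// Gd// ltW.
Unshelve. all: by end_near. Qed.

Let S x := (\int[ne]_(y in `[0%R, 1%R])
  ((fine (tail po x) - fine (tail po (x + y)%R)) / fine (tail po x))%:E)%E.

Let J x := (\int[ne]_(y in `[0%R, 1%R]) po `]x, (x + y)%R]%classic)%E.

Let S_J x : 0 < x -> S x = ((G x)^-1%:E * J x)%E.
Proof.
move=> x0; rewrite /J -ge0_integralZl//; last 2 first.
- by apply: measurable_funTS; exact: measurable_mass_oc.
- by rewrite lee_fin invr_ge0.
apply: eq_integral => y /set_mem /=; rewrite in_itv/= => /andP[y0 _].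
by rewrite mass_ocE ?po_fin// ?lerDl// -EFinM mulrC.
Qed.

Lemma small_jumps_cvg : positive_on_pos G -> negligible_wrt A G ->
  S x @[x --> +oo] --> 0%:E.
Proof.
move=> G0 AG.
have S0 x : 0 < x -> (0 <= S x)%E.
  move=> x0; rewrite S_J// mule_ge0 ?lee_fin ?invr_ge0//.
  by apply: integral_ge0.
have H (e : R) : 0 < e -> \forall x \near +oo, (S x <= e%:E)%E.
  move=> e0; have [M [_ HM]] := AG _ e0; near=> x.
  have x0 : 0 < x by near: x; exact: near_pinfty_gt.
  have xM : M < x by near: x; exact: near_pinfty_gt.
  have Gx := G0 _ x0.
  have : (J x <= (e * G x)%:E)%E.
    apply: (small_jumps_le _ _ spo sne) => y xy.
    have y0 := lt_trans x0 xy.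
    rewrite overshoot_fineE// lee_fin.
    apply: le_trans (HM y (lt_trans xM xy)) _.
    by rewrite ler_wpM2l ?(ltW e0)// Gd// ltW.
  move=> Jx; rewrite S_J//.
  apply: (@le_trans _ _ ((G x)^-1%:E * (e * G x)%:E)%E).
    by apply: lee_wpmul2l => //; rewrite lee_fin invr_ge0.
  by rewrite -EFinM lee_fin mulrCA mulVf ?mulr1// gt_eqF.
apply/fine_cvgP; split.
  have H1 := H _ ltr01; near=> x.
  have x0 : 0 < x by near: x; exact: near_pinfty_gt.
  rewrite ge0_fin_numE ?S0//.
  apply: (@le_lt_trans _ _ 1%:E); last by rewrite ltry.
  by near: x.
apply/cvgrPdist_le => e e0; have He := H _ e0; near=> x.
have x0 : 0 < x by near: x; exact: near_pinfty_gt.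
have Sx : (S x <= e%:E)%E by near: x.
rewrite sub0r normrN /= ger0_norm ?fine_ge0 ?S0// -lee_fin fineK//.
by rewrite ge0_fin_numE ?S0//; apply: le_lt_trans Sx _; rewrite ltry.
Unshelve. all: by end_near. Qed.

(** The three terms of [overshoot_le] are made at most [e / 3 * G x], the
    last one by the choice of [K] and then the middle one by slow decay. *)
Lemma negligible_overshoot : positive_on_pos G -> slowly_decaying G ->
  S x @[x --> +oo] --> 0%:E -> negligible_wrt A G.
Proof.
move=> G0 Gs /fine_cvgP[Sfin /cvgrPdist_le Scvg] e e0.
have e3 : 0 < e / 3 by rewrite divr_gt0.
have H3 := Scvg _ e3.
have [K K1 tK] := tail_vanishes ne ne_fin _ e3.
(* The gap is required to be below [e / 3 / (c + 1)], as [c] may be 0. *)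
pose c := fine (tail ne 1).
have c0 : 0 <= c by rewrite fine_ge0// tail_ge0.
have ec : 0 < e / 3 / (c + 1) by rewrite divr_gt0// ltr_wpDl.
have := slowly_decaying_gap G 0 K G0 Gs _ ec => HK.
near=> x.
have x0 : 0 < x by near: x; exact: near_pinfty_gt.
have Gx := G0 _ x0.
have Sx : S x \is a fin_num by near: x.
have Sx3 : `|0 - fine (S x)| <= e / 3 by near: x.
have : G (x + 0) - G (x + K) <= e / 3 / (c + 1) * G x by near: x.
rewrite addr0 => gap.
have JE : J x = ((G x)%:E * S x)%E.
  by rewrite S_J// muleA -EFinM divff ?mul1e// gt_eqF.
have := overshoot_le po ne spo sne x K K1.
rewrite -/(J x) JE -(fineK Sx) mass_ocE ?po_fin//; last lra.
rewrite (tail_fineE ne 1 (ne_fin _ ltr01)) (tail_fineE po x (po_fin _ x0)).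
rewrite (tail_fineE ne K); last by apply: ne_fin; lra.
rewrite overshoot_fineE// -!EFinM -!EFinD lee_fin => h.
apply: (le_trans h).
have h1 : G x * fine (S x) <= e / 3 * G x.
  rewrite mulrC ler_wpM2r//; move: Sx3; rewrite sub0r normrN.
  exact: le_trans (ler_norm _).
have h2 : c * (G x - G (x + K)) <= e / 3 * G x.
  apply: (@le_trans _ _ ((c + 1) * (e / 3 / (c + 1) * G x))).
    apply: (@le_trans _ _ ((c + 1) * (G x - G (x + K)))).
      by rewrite ler_wpM2r ?subr_ge0 ?Gd//; lra.
    by rewrite ler_wpM2l//; lra.
  by rewrite mulrA mulrCA divff ?mulr1// gt_eqF// ltr_wpDl.
have h3 : fine (tail ne K) * G x <= e / 3 * G x.
  rewrite ler_wpM2r ?(ltW Gx)// -lee_fin fineK// ge0_fin_numE ?tail_ge0//.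
  by apply: ne_fin; lra.
move: h1 h2 h3; rewrite /G /c /=; lra.
Unshelve. all: by end_near. Qed.



Section killing.
Variable V : {measure set (measurableTypeR R) -> \bar R}.
Hypothesis khat_gt0 : 0 < khat.
Hypothesis V_mass : V `[0%R, +oo[%classic = khat^-1%:E.
Hypothesis vigon_po : forall x : R, 0 < x ->
  tail po x = (\int[V]_(y in `[0%R, +oo[) tail Pi (x + y)%R)%E.

(** The first statement implies the second by way of the third, which makes
    the remainder negligible. *)
Lemma killed_equivalence :
  let b1 := long_tailed (positive_part Pi) in
  let b2 := [/\ long_tailed po,
     drhat * p x / fine (tail po x) @[x --> +oo] --> (0 : R) &
     (\int[ne]_(y in `[0%R, 1%R])
        ((fine (tail po x) - fine (tail po (x + y)%R)) /
         fine (tail po x))%:E)%E @[x --> +oo%R] --> 0%:E] in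
  let b3 := asymp_equiv (fun x => fine (tail po x))
              (fun x => khat^-1 * fine (tail Pi x)) in
  ((0 < ne `]0%R, +oo[%classic)%E \/ 0 < drhat -> [<-> b1; b2; b3]) /\
  (b1 <-> b2) /\ (b2 -> b3).
Proof.
move=> b1 b2 b3; pose Q := fine \o tail Pi.
have b1P : b1 <-> positive_on_pos Q /\ slowly_decaying Q.
  exact: long_tailed_positive_partP.
have poP : long_tailed po <-> positive_on_pos G /\ slowly_decaying G.
  exact: long_tailed_on_posP.
have Gge0 (x : R) : 0 < x -> 0 <= G x by [].
have Age0 (x : R) : 0 < x -> 0 <= A x by [].
have rge0 (x : R) : 0 < x -> 0 <= r x by exact: creeping_ge0.
have Qd : nonincreasing_on_pos Q by exact: fine_tail_nonincreasing.
have QE (x : R) : 0 < x -> Q x = A x + r x + khat * G x by exact: vigon_Pi_fine.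
have b2I : long_tailed po -> negligible_wrt (A \+ r) G -> b2.
  move=> po_long Ar; have [G0 Gs] := poP.1 po_long; split => //.
    apply/cvgrPdist_le => e e0; near=> x.
    have x0 : 0 < x by near: x; exact: near_pinfty_gt.
    have Gx := G0 _ x0; have rx := rge0 _ x0.
    have Ax : A x + r x <= e * G x by near: x; exact: Ar.
    rewrite sub0r normrN ger0_norm; last first.
      by rewrite divr_ge0 ?fine_ge0 ?tail_ge0.
    rewrite ler_pdivrMr//.
    by apply: le_trans Ax; rewrite lerDr.
  apply: small_jumps_cvg => // e e0; near=> x.
  have x0 : 0 < x by near: x; exact: near_pinfty_gt.
  have Ax : A x + r x <= e * G x by near: x; exact: Ar.
  by apply: le_trans Ax; rewrite lerDl rge0.
have b23 : b2 -> b3.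
  move=> [/poP[G0 Gs] rG SG].
  apply: (equiv_of_remainder G Q A r khat khat_gt0 Age0 rge0 QE G0) => e e0.
  have e2 : 0 < e / 2 by rewrite divr_gt0.
  have AG := negligible_overshoot G0 Gs SG _ e2.
  have /cvgrPdist_le/(_ _ e2) rG' := rG; near=> x.
  have x0 : 0 < x by near: x; exact: near_pinfty_gt.
  have Gx := G0 _ x0.
  have Ax : A x <= e / 2 * G x by near: x.
  have : `|0 - drhat * p x / fine (tail po x)| <= e / 2 by near: x.
  rewrite sub0r normrN => /(le_trans (ler_norm _)).
  rewrite ler_pdivrMr// => rx; rewrite /= /r.
  by move: Ax rx; rewrite /G /=; lra.
have b12 : b1 -> b2.
  move=> /b1P[Q0 Qs].
  have GQ : asymp_equiv G (fun x => khat^-1 * Q x).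
    apply: (equiv_of_renewal G Q A r) => //.
    exact: (renewal_lower_bound Pi po V khat khat_gt0 po_fin Pi_fin V_mass
      vigon_po).
  have [G0 Ar] := remainder_of_equiv G Q A r khat khat_gt0 Gge0 Gd QE GQ.
  apply: (b2I _ Ar); apply/poP; split => //.
  apply: (@slowly_decaying_equiv _ G Q khat^-1) => //.
    by rewrite invr_neq0// gt_eqF.
  have : khat^-1 * (G x / (khat^-1 * Q x)) @[x --> +oo] --> khat^-1.
    by rewrite -[X in _ --> X]mulr1; apply: cvgM; [exact: cvg_cst|exact: GQ].
  apply: near_eq_cvg_to; near=> x.
  have x0 : 0 < x by near: x; exact: near_pinfty_gt.
  by field; rewrite !gt_eqF// Q0.
have b21 : b2 -> b1.
  move=> b2h; have GQ := b23 b2h; case: b2h => /poP[G0 Gs] _ _.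
  have Q0 : positive_on_pos Q.
    move=> x x0; rewrite QE// ltr_wpDl ?addr_ge0 ?rge0//.
    by rewrite mulr_gt0// G0.
  apply/b1P; split => //; apply: (@slowly_decaying_equiv _ Q G khat) => //.
    by rewrite gt_eqF.
  have : khat * (G x / (khat^-1 * Q x))^-1 @[x --> +oo] --> khat.
    rewrite -[X in _ --> X]mulr1.
    by apply: cvgM; [exact: cvg_cst|exact: (cvg1V _ GQ)].
  apply: near_eq_cvg_to; near=> x.
  have x0 : 0 < x by near: x; exact: near_pinfty_gt.
  by field; rewrite !gt_eqF// ?Q0 ?G0.
split=> [nontrivial|]; last by split.
tfae => // GQ; apply: b21.
have [G0 Ar] := remainder_of_equiv G Q A r khat khat_gt0 Gge0 Gd QE GQ.
apply: (b2I _ Ar); apply/poP; split => //.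
exact: slowly_of_negligible_remainder.
Unshelve. all: by end_near. Qed.

End killing.

End ladder_pair.

(** * The equivalences *)

(* The implications out of the asymptotic equivalences require [ne] to be
   nonzero (resp. the dual ladder height process not to be identically 0 up to
   its killing time).  Otherwise they fail: for xi_t = - t + (compound Poisson
   of rate 1/2 with exponential(1) jumps) one has Hhat_t = t, so po and Pi_I^+
   have the same tail e^{-x}/2, which is not long tailed; for a compound
   Poisson subordinator xi, Hhat is 0 until it is killed and the tail of po is
   the tail of Pi divided by khat for every Pi. *)
Theorem theorem5 (R : realType) (disp : measure_display)
    (T : measurableType disp) (P : probability T R)
    (F : R -> set (set T)) (xi : R -> T -> R)
    (Pi : {measure set (measurableTypeR R) -> \bar R})
    (L Lhat : R -> T -> R)
    (k dr khat drhat : R)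
    (po ne Vhat : {measure set (measurableTypeR R) -> \bar R})
    (p : R -> R)
    (xi_levy : levy_process P F xi)
    (Pi_levy : levy_measure_of P xi Pi)
    (Pi_pos : (0 < Pi `]0%R, +oo[%classic)%E)
    (L_local_time : local_time_at_max P F xi L)
    (Lhat_local_time : local_time_at_max P F (dual_process xi) Lhat)
    (H_sub : killed_subordinator P (ladder_height xi L))
    (Hhat_sub : killed_subordinator P (ladder_height (dual_process xi) Lhat))
    (H_char : characteristics P (ladder_height xi L) k dr po)
    (Hhat_char :
      characteristics P (ladder_height (dual_process xi) Lhat) khat drhat ne)
    (Vhat_pot :
      potential_measure_of P (ladder_height (dual_process xi) Lhat) Vhat)
    (vigon_po : forall x : R, 0 < x ->
      tail po x = (\int[Vhat]_(y in `[0%R, +oo[) tail Pi (x + y)%R)%E)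
    (p_density : 0 < drhat -> density_on_pos po p)
    (vigon_Pi : forall x : R, 0 < x ->
      tail Pi x = (\int[po]_(y in `]x, +oo[) tail ne (y - x)%R
                   + (drhat * p x)%:E + khat%:E * tail po x)%E) :
  (forall mu : R,
     (\int[P]_w ladder_height (dual_process xi) Lhat 1 w)%E = mu%:E ->
     let a1 := long_tailed (integrated_tail Pi) in
     let a2 := long_tailed po in
     let a3 := asymp_equiv (fun x => fine (tail po x))
                 (fun x => mu^-1 * fine (tail (integrated_tail Pi) x)) in
     ((0 < ne `]0%R, +oo[%classic)%E -> [<-> a1; a2; a3]) /\
     (a1 <-> a2) /\ (a2 -> a3))
  /\
  (0 < khat ->
     let b1 := long_tailed (positive_part Pi) in
     let b2 := [/\ long_tailed po,
        drhat * p x / fine (tail po x) @[x --> +oo] --> (0 : R) &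
        (\int[ne]_(y in `[0%R, 1%R])
           ((fine (tail po x) - fine (tail po (x + y)%R)) /
            fine (tail po x))%:E)%E @[x --> +oo%R] --> 0%:E] in
     let b3 := asymp_equiv (fun x => fine (tail po x))
                 (fun x => khat^-1 * fine (tail Pi x)) in
     ((0 < ne `]0%R, +oo[%classic)%E \/ 0 < drhat -> [<-> b1; b2; b3]) /\
     (b1 <-> b2) /\ (b2 -> b3)).
Proof.
have [[khat0 drhat0] ne0 ne_min Hhat_lap] := Hhat_char.
have [_ po0 po_min _] := H_char.
have [_ Pi_min _] := Pi_levy.
have po_fin (x : R) : 0 < x -> (tail po x < +oo)%E.
  exact: tail_lty_min.
have ne_fin (x : R) : 0 < x -> (tail ne x < +oo)%E.
  exact: tail_lty_min.
have Pi_fin (x : R) : 0 < x -> (tail Pi x < +oo)%E.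
  exact: tail_lty_min_sqr.
split=> [mu mean_mu|khat_gt0].
  have [mH _ Hge0 _ _] := Hhat_sub.
  have [khatE meanE] : khat = 0 /\
      (drhat%:E + \int[ne]_(x in `]0%R, +oo[) x%:E = mu%:E)%E.
    apply: killed_subordinator_mean mean_mu => //; first exact: mH.
      by move=> w; have /andP[] := Hge0 w _ _ ler01 (lexx 1).
    by move=> l l0; rewrite Hhat_lap// mul1r.
  exact: (finite_mean_equivalence Pi po ne drhat khat p).
have Vhat_mass : Vhat `[0%R, +oo[%classic = khat^-1%:E.
  rewrite Vhat_pot; last exact: measurable_itv.
  exact: potential_mass Hhat_sub Hhat_char khat_gt0.
exact: (killed_equivalence Pi po ne drhat khat p po0 po_fin ne0 ne_fin Pi_fin
  drhat0 khat0 p_density vigon_Pi Vhat).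
Qed.
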